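(* Exact-Exists-Swap is solvable in $O(n^4)$ time.
   Context: A Stable Marriage (SM) instance consists of a set $U$ of men and a set $W$ of women with $|U|=|W|=n$, and for every agent a strict total order (preference list) over all agents of the opposite gender. A matching is a set of man–woman pairs in which each agent appears at most once; it is complete if every agent is in a pair. A man–woman pair $\{m,w\}$ blocks a matching $M$ if ($m$ is unassigned or prefers $w$ to his partner in $M$) and ($w$ is unassigned or prefers $m$ to her partner in $M$); $M$ is stable if no pair blocks it. A Swap action exchanges two adjacent agents in the preference list of one agent, at cost one. Exact-Exists-Swap: given an SM instance, a complete matching $M^*$ and a budget $\ell$, decide whether at most $\ell$ swaps can be performed such that $M^*$ is stable in the altered instance. *)

(* Defs.v *)
From mathcomp Require Import all_boot.
Set Implicit Arguments. Unset Strict Implicit. Unset Printing Implicit Defensive.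

(* Men and women are both indexed by 'I_n.  A preference profile gives,
   for each man (resp. woman), his (her) preference list: a sequence of
   women (resp. men), most preferred first.  A valid list is a permutation
   of all agents of the other gender (strict total order). *)

Definition profile (n : nat) : Type :=
  (('I_n -> seq 'I_n) * ('I_n -> seq 'I_n))%type.

Definition valid_profile n (P : profile n) : Prop :=
  (forall m, perm_eq (P.1 m) (enum 'I_n)) /\
  (forall w, perm_eq (P.2 w) (enum 'I_n)).

Definition swap_at (T : Type) (i : nat) (s : seq T) : seq T :=
  match drop i s with
  | x :: y :: r => take i s ++ y :: x :: r
  | _ => s
  end.

(* a Swap action: (side, agent, position); side = true : a man's list,
   side = false : a woman's list; it swaps positions i and i+1. *)
Definition swap_action (n : nat) : Type := (bool * 'I_n * nat)%type.

Definition valid_action n (a : swap_action n) : bool := (a.2).+1 < n.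

Definition apply_action n (P : profile n) (a : swap_action n) : profile n :=
  let: (side, x, i) := a in
  if side then ((fun y => if y == x then swap_at i (P.1 y) else P.1 y), P.2)
  else (P.1, (fun y => if y == x then swap_at i (P.2 y) else P.2 y)).

(* A complete matching is given by a bijection mu : men -> women
   (man m is matched with woman mu m). *)
Definition stable n (P : profile n) (mu : 'I_n -> 'I_n) : Prop :=
  forall (m w m' : 'I_n), mu m' = w ->
    ~ (index w (P.1 m) < index (mu m) (P.1 m) /\
       index m (P.2 w) < index m' (P.2 w)).

Definition EES n (P : profile n) (mu : 'I_n -> 'I_n) (ell : nat) : Prop :=
  exists s : seq (swap_action n),
    [/\ size s <= ell, all (@valid_action n) s & stable (foldl (@apply_action n) P s) mu].

(* Computation model: unit-cost RAM (memory cells indexed by nat,      *)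
(* holding nats; direct and indirect addressing; addition, truncated   *)
(* subtraction, zero test). Each executed instruction costs 1.         *)
Inductive instr : Type :=
  | IConst of nat & nat
  | IAdd of nat & nat & nat
  | ISub of nat & nat & nat
  | ILoad of nat & nat
  | IStore of nat & nat
  | IJz of nat & nat
  | IJmp of nat
  | IHalt.

Definition memory := nat -> nat.

Definition upd (M : memory) (r v : nat) : memory :=
  fun a => if a == r then v else M a.

Definition step (i : instr) (pc : nat) (M : memory) : nat * memory :=
  match i with
  | IConst r k => (pc.+1, upd M r k)
  | IAdd r a b => (pc.+1, upd M r (M a + M b))
  | ISub r a b => (pc.+1, upd M r (M a - M b))
  | ILoad r a => (pc.+1, upd M r (M (M a)))
  | IStore a r => (pc.+1, upd M (M a) (M r))
  | IJz a t => (if M a == 0 then t else pc.+1, M)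
  | IJmp t => (t, M)
  | IHalt => (pc, M)
  end.

(* run with at most fuel executed instructions; Some M if the program
   reaches a Halt (or falls off the program) within that budget *)
Fixpoint run (prog : seq instr) (fuel pc : nat) (M : memory) : option memory :=
  match nth IHalt prog pc with
  | IHalt => Some M
  | i => match fuel with
         | 0 => None
         | f.+1 => let: (pc', M') := step i pc M in run prog f pc' M'
         end
  end.

(* Input encoding: M[0] = n, M[1] = ell,
   M[2 + m*n + j]         = j-th entry of man m's list,
   M[2 + n*n + w*n + j]   = j-th entry of woman w's list,
   M[2 + 2*n*n + m]       = mu m,   all other cells 0. *)
Definition lookup_list n (f : 'I_n -> seq 'I_n) (k : nat) : nat :=
  match @insub nat (fun x => x < n) 'I_n (k %/ n) with
  | Some m => nth 0 (map val (f m)) (k %% n)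
  | None => 0
  end.

Definition encode n (P : profile n) (mu : 'I_n -> 'I_n) (ell : nat) : memory :=
  fun a =>
    if a == 0 then n
    else if a == 1 then ell
    else if a < 2 + n * n then lookup_list P.1 (a - 2)
    else if a < 2 + 2 * (n * n) then lookup_list P.2 (a - (2 + n * n))
    else match @insub nat (fun x => x < n) 'I_n (a - (2 + 2 * (n * n))) with
         | Some m => val (mu m)
         | None => 0
         end.

(* Main.v *)
Require Import Defs.
From mathcomp Require Import all_boot zify.
Set Implicit Arguments. Unset Strict Implicit. Unset Printing Implicit Defensive.

(** Every pair [{m, w}] that blocks [mu] must be repaired on one of its two sides, by moving the partner of
    that agent above the other one. A swap changes the distance between two entries of a list by at most
    one, except that it may exchange neighbours; so lifting the partner above an agent [d] places ahead
    costs [d] swaps and repairs all nearer pairs for free. Hence the optimum is the least total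
    [\sum_a K a] of nonnegative thresholds such that each blocking pair is within the threshold of one of
    its members.

    This is a minimum cut: the node [(a, d)] stands for the question whether [K a >= d]; the nodes of an
    agent form a chain, each blocking pair gives one cross arc from a node of the man to a node of the
    woman, a man's node has supply one and a woman's node has demand one. There are [O(n^2)] nodes, each of
    degree at most four, so the flow value is [O(n^2)] and each of the [O(n^2)] breadth-first searches of
    Ford and Fulkerson costs [O(n^2)].

    On the machine, all loops run for a fixed number [F = O(n^2)] of rounds and are nested at most twice,
    so that the time bound [O(F^2) = O(n^4)] is read off from the program text. *)

(** * Swaps and thresholds *)

(** Chain and cross arcs have unlimited capacity; only supplies and demands can be cut. A finite cut
    is therefore a set of nodes closed under arcs, and closure along the chain of one agent is
    exactly what turns a set of nodes into a threshold. Since a list has no ties, different blocking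
    pairs use different nodes, so every node has at most one cross arc and two arrays suffice to
    store them. The set visited by a failed search is itself the cut that certifies optimality.

    The machine dictates the rest. Without multiplication, offsets, addresses and [F] come from
    repeated addition; sixteen arrays are interleaved because four doublings scale an index by 16.
    The input fills the low cells without a gap, so room must be made before compiled code can run.
    No loop is left early: a round with nothing to do is idle, and the loop invariants say that
    either every round so far made progress or the work is done. A bound by [N] on the queue length
    or on the flow value then shows that [F] rounds are enough. *)

Section Swaps.
Variable T : eqType.
Implicit Types (s : seq T) (x y z : T).

Lemma index_swap_at s i z : uniq s -> i.+1 < size s ->
  index z (swap_at i s) =
    if index z s == i then i.+1 else if index z s == i.+1 then i else index z s.
Proof.
move=> us lti; rewrite /swap_at; move: (congr1 size (erefl (drop i s))).
have sz : size (take i s) = i by rewrite size_take; case: ltnP => //; lia.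
have : size (drop i s) = size s - i by rewrite size_drop.
rewrite -(cat_take_drop i s) in us lti *; rewrite take_size_cat // drop_size_cat //.
move: (take i s) (drop i s) sz us lti => p q sz us lti sq _.
case: q us lti sq => [|x [|y r]] us lti sq; try by move: lti; rewrite size_cat /=; lia.
move: us; rewrite cat_uniq => /and3P[_ /hasPn hn us]; move: us; rewrite !cons_uniq => /and3P[xn yn _].
have xt : x \notin p by apply: hn; rewrite inE eqxx.
have yt : y \notin p by apply: hn; rewrite !inE eqxx orbT.
have nxy : x != y by move: xn; rewrite inE negb_or => /andP[].
rewrite !index_cat sz /=; case: ifP => zt.
  by have : index z p < i; [rewrite -sz index_mem|case: eqP; [lia|case: eqP => //; lia]].
rewrite (eq_sym x z) (eq_sym y z); case: (eqVneq z x) => [->|nzx].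
  by rewrite (negbTE nxy) addn0 eqxx addn1.
case: (eqVneq z y) => [_|nzy]; first by rewrite addn0 addn1 eqxx; case: eqP => //; lia.
by case: eqP; [lia|case: eqP => //; lia].
Qed.

Lemma swap_at_perm s i : perm_eq (swap_at i s) s.
Proof.
rewrite /swap_at; case E: (drop i s) => [|x [|y r]] //.
rewrite -{2}(cat_take_drop i s) E perm_cat2l.
by rewrite -cat1s -(cat1s x r) -(cat1s x (y :: r)) -(cat1s y r) perm_catCA.
Qed.

Lemma swap_at_oversize s i : size s <= i.+1 -> swap_at i s = s.
Proof.
move=> le; rewrite /swap_at; case E: (drop i s) => [|x [|y r]] //.
by move: (congr1 size E); rewrite size_drop /=; lia.
Qed.

(** Exchanging [x] and [y] themselves would change their gap by two, but the successor in the
    hypothesis keeps them non-adjacent, and any other swap changes the gap by at most one. *)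
Lemma swap_at_gap s i x y c : uniq s ->
  index x s + c.+1 < index y s -> index x (swap_at i s) + c < index y (swap_at i s).
Proof.
move=> us lt; case: (ltnP i.+1 (size s)) => [lti|ge]; last by rewrite swap_at_oversize //; lia.
rewrite !index_swap_at //; do 4?case: eqP; lia.
Qed.

End Swaps.

#[local] Arguments apply_action : simpl never.

(** * Swap sequences and covering thresholds *)

Section Thresholds.
Variable n : nat.
Implicit Types (P : profile n) (a b : bool * 'I_n) (s : seq (swap_action n)).

(** An agent is coded as in the first component of a swap action, so one statement serves both sides
    and [t.1 == a] selects the swaps in the list of [a]. *)
Definition pref P a : seq 'I_n := if a.1 then P.1 a.2 else P.2 a.2.

Lemma pref_apply P a i b :
  pref (apply_action P ((a, i) : swap_action n)) b = if b == a then swap_at i (pref P b) else pref P b.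
Proof.
case: a b => [[] x] [[] y]; rewrite /pref /apply_action /= ?xpair_eqE //=.
all: by case: eqP.
Qed.

Lemma valid_prefP P : valid_profile P <-> forall a, perm_eq (pref P a) (enum 'I_n).
Proof.
split=> [[v1 v2] [[] x]|v]; [exact: v1|exact: v2|].
by split=> x; [apply: (v (true, x))|apply: (v (false, x))].
Qed.

Lemma valid_apply P (a : swap_action n) : valid_profile P -> valid_profile (apply_action P a).
Proof.
move/valid_prefP => v; apply/valid_prefP => b; case: a => a i; rewrite pref_apply.
by case: eqP => // _; rewrite (perm_trans (swap_at_perm _ _)).
Qed.

Lemma pref_uniq P a : valid_profile P -> uniq (pref P a).
Proof. by move/valid_prefP/(_ a)/perm_uniq->; rewrite enum_uniq. Qed.

Lemma size_pref P a : valid_profile P -> size (pref P a) = n.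
Proof. by move/valid_prefP/(_ a)/perm_size->; rewrite size_enum_ord. Qed.

Lemma mem_pref P a x : valid_profile P -> x \in pref P a.
Proof. by move/valid_prefP/(_ a)/perm_mem->; rewrite mem_enum. Qed.

Lemma few_swaps_keep_order s P a x y : valid_profile P ->
  index x (pref P a) + count (fun t => t.1 == a) s < index y (pref P a) ->
  index x (pref (foldl (@apply_action n) P s) a)
    < index y (pref (foldl (@apply_action n) P s) a).
Proof.
elim: s P => [|[b i] s IH] P vP /=; first by rewrite addn0.
move=> lt; apply: IH; first exact: valid_apply.
move: lt; rewrite pref_apply; case: (eqVneq b a) => [_|_] //.
by rewrite add1n => lt; apply: swap_at_gap => //; apply: pref_uniq.
Qed.

(** The witness bubbles [y] forward, one neighbour per swap, stopping at the head of the list.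
    Nobody overtakes [y], so whoever is still ahead was more than [c] places ahead; for [y] the
    partner of [a], no blocking pair is created. *)
Lemma promote P a y c : valid_profile P -> exists s,
  [/\ size s <= c, all (@valid_action n) s,
      forall b, b != a -> pref (foldl (@apply_action n) P s) b = pref P b,
      valid_profile (foldl (@apply_action n) P s)
    & forall z, index z (pref (foldl (@apply_action n) P s) a)
                  < index y (pref (foldl (@apply_action n) P s) a) ->
                index z (pref P a) + c < index y (pref P a)].
Proof.
elim: c P => [|c IH] P vP; first by exists [::]; split=> // z; rewrite addn0.
case E: (index y (pref P a)) => [|p].
  by exists [::]; split=> // z /=; rewrite E ltn0.
have us := pref_uniq a vP.
have ltp : p.+1 < size (pref P a) by rewrite -E index_mem mem_pref.
set P' := apply_action P ((a, p) : swap_action n).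
have vP' : valid_profile P' by apply: valid_apply.
have [s [ss vs os vl hz]] := IH P' vP'.
exists ((a, p) :: s); split=> //=.
- by rewrite vs andbT /valid_action /= -(size_pref a vP).
- by move=> b nb; rewrite os // /P' pref_apply (negbTE nb).
- move=> z /hz; rewrite /P' pref_apply eqxx !index_swap_at // E eqxx.
  by do 3?case: eqP; lia.
Qed.

(** Promotions for different agents touch different lists and do not interfere. *)
Lemma promote_many P (f : bool * 'I_n -> 'I_n) K (r : seq (bool * 'I_n)) :
  valid_profile P -> uniq r -> exists s,
  [/\ size s <= \sum_(a <- r) K a, all (@valid_action n) s,
      forall b, b \notin r -> pref (foldl (@apply_action n) P s) b = pref P b,
      valid_profile (foldl (@apply_action n) P s)
    & forall a, a \in r ->
      forall z, index z (pref (foldl (@apply_action n) P s) a)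
                  < index (f a) (pref (foldl (@apply_action n) P s) a) ->
                index z (pref P a) + K a < index (f a) (pref P a)].
Proof.
move=> vP; elim: r => [|a r IH] /=; first by exists [::]; split.
case/andP=> ar /IH[s [ss vs os vl hz]].
have [t [st vt ot vt' tz]] := promote a (f a) (K a) vl.
exists (s ++ t); rewrite foldl_cat; split=> //.
- by rewrite size_cat big_cons addnC leq_add.
- by rewrite all_cat vs.
- by move=> b; rewrite inE negb_or => /andP[nb br]; rewrite ot // os.
- move=> b; rewrite inE; case: (eqVneq b a) => [-> _|nb /= br] z.
    by move/tz; rewrite os.
  by rewrite ot //; apply: hz.
Qed.

Variables (mu nu : 'I_n -> 'I_n).
Hypotheses (muK : cancel mu nu) (nuK : cancel nu mu).

Definition partner a : 'I_n := if a.1 then mu a.2 else nu a.2.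

Definition covering P (K : bool * 'I_n -> nat) : Prop :=
  forall m w, index w (P.1 m) < index (mu m) (P.1 m) ->
              index m (P.2 w) < index (nu w) (P.2 w) ->
    index (mu m) (P.1 m) - index w (P.1 m) <= K (true, m) \/
    index (nu w) (P.2 w) - index m (P.2 w) <= K (false, w).

(** Given swaps, [K a] counts those spent on the list of [a]; given [K], the partner of every agent
    [a] is promoted by [K a] places. *)
Lemma EES_covering P ell : valid_profile P ->
  EES P mu ell <-> exists2 K, covering P K & \sum_a K a <= ell.
Proof.
move=> vP; split=> [[s [ss vs st]]|[K cK sK]].
  exists (fun a => count (fun t => t.1 == a) s) => [m w lt1 lt2|].
    case: leqP => [_|/= c1]; [by left|right]; case: leqP => //= c2.
    (* Both distances exceed the numbers of swaps spent, so neither order was reversed and the pair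
       still blocks. *)
    case: (st m w (nu w) (nuK w)); split.
      by apply: (@few_swaps_keep_order s P (true, m)) => //=; rewrite /pref /=; lia.
    by apply: (@few_swaps_keep_order s P (false, w)) => //=; rewrite /pref /=; lia.
  apply: leq_trans ss; clear -s; elim: s => [|[a i] s IH]; first by rewrite big1.
  rewrite /= (eq_bigr (fun b => (a == b) + count (fun t => t.1 == b) s)) //.
  rewrite big_split /= (bigD1 a) //= eqxx big1 ?addn0 ?add1n ?ltnS //.
  by move=> b /negbTE; rewrite eq_sym => ->.
have ue : uniq (index_enum (bool * 'I_n)%type) by apply: index_enum_uniq.
have [s [ss vs os vl hz]] := promote_many partner K vP ue.
exists s; split=> //; first exact: leq_trans ss sK.
move=> m w m' mw [lt1 lt2].
have h1 := hz (true, m) (mem_index_enum _) w lt1.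
have em : m' = nu w by rewrite -mw muK.
rewrite em in lt2.
have h2 := hz (false, w) (mem_index_enum _) m lt2.
rewrite /pref /partner /= in h1 h2.
(* A pair that blocks after the promotions blocked before them, at distances exceeding both
   thresholds. *)
case: (cK m w (leq_ltn_trans (leq_addr _ _) h1) (leq_ltn_trans (leq_addr _ _) h2));
  rewrite leq_subLR => le.
- by have := leq_trans h1 le; rewrite ltnn.
- by have := leq_trans h2 le; rewrite ltnn.
Qed.

End Thresholds.

(** * Flows with unit supplies and demands *)

Ltac gen_sums :=
  repeat match goal with |- context [bigop ?x ?r ?F] => move: (bigop x r F) => ? end.

Section Flow.

(* Nodes are the numbers below [N]. The chain arc into [u], present when [C u != 0], comes from [u.-1];
   the cross arc out of [v], present when [O v = u.+1], goes to [u]. An arc is named by its kind and its head,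
   and [I u] is the tail of the cross arc into [u]. *)
Variables (N : nat) (C O I S0 T0 : nat -> nat).
Hypothesis C_node : forall u, C u != 0 -> 0 < u < N.
Hypothesis O_node : forall v u, O v = u.+1 -> [/\ v < N, u < N & I u = v].
Implicit Types (S T g : nat -> nat) (X : pred nat).

Definition cross_out g2 v := if O v is u.+1 then g2 u else 0.

(* [S v] and [T v] are the unused supply and demand of [v]; the defect [(v == x)] describes an
   augmentation that has so far been carried out between the sink and [x]. *)
Record defect_flow (x : nat) S T g1 g2 : Prop := DefectFlow {
  flow_eq : forall v, v < N ->
    S0 v + T v + (g1 v + g2 v) + (v == x) = T0 v + S v + (g1 v.+1 + cross_out g2 v);
  flow_S : forall v, S v <= 1;
  flow_T : forall v, T v <= 1;
  flow_g1 : forall u, g1 u != 0 -> C u != 0;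
  flow_g2 : forall u, g2 u != 0 -> O (I u) = u.+1 }.

(* [N] is not a node, so there is no defect. *)
Definition flow := defect_flow N.

Lemma defect_flow_ext x S T g1 g2 S' T' g1' g2' :
  S =1 S' -> T =1 T' -> g1 =1 g1' -> g2 =1 g2' ->
  defect_flow x S T g1 g2 -> defect_flow x S' T' g1' g2'.
Proof.
move=> eS eT e1 e2 [h hS hT h1 h2]; split=> [v ltv|v|v|u|u].
- have -> : cross_out g2' v = cross_out g2 v by rewrite /cross_out; case: (O v).
  by rewrite -eS -eT -!e1 -e2; apply: h.
- by rewrite -eS.
- by rewrite -eT.
- by rewrite -e1; apply: h1.
- by rewrite -e2; apply: h2.
Qed.

Definition arc_closed X : Prop :=
  (forall u, C u.+1 != 0 -> X u -> X u.+1) /\ (forall v u, O v = u.+1 -> X v -> X u).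

(** With [X] as the source side, the cut arcs lead from the source to supplies outside [X] and from
    demands inside [X] to the sink. *)
Definition cut X := \sum_(v < N) if X v then T0 v else S0 v.

(** Expressing cross flow at tails and at heads by the same incidence matrix allows the two to be
    compared by exchanging sums. *)
Lemma cross_outE S T g1 g2 x v : defect_flow x S T g1 g2 ->
  cross_out g2 v = \sum_(u < N) (O v == u.+1) * g2 u.
Proof.
move=> f; rewrite /cross_out; case E: (O v) => [|u].
  by rewrite big1.
have [ltv ltu _] := O_node E.
rewrite (bigD1 (Ordinal ltu)) //= eqxx mul1n big1 ?addn0 // => i ne.
by rewrite eqSS; case: eqP => [e|//]; case/negP: ne; apply/eqP/val_inj.
Qed.

Lemma cross_inE S T g1 g2 x u : defect_flow x S T g1 g2 -> u < N ->
  g2 u = \sum_(v < N) (O v == u.+1) * g2 u.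
Proof.
move=> f ltu; case: (eqVneq (g2 u) 0) => [->|nz].
  by rewrite big1 // => i _; rewrite muln0.
have e := flow_g2 f nz; have [ltv _ _] := O_node e.
rewrite (bigD1 (Ordinal ltv)) //= e eqxx mul1n big1 ?addn0 // => i ne.
case: eqP => [e'|//]; case/negP: ne; apply/eqP/val_inj => /=.
by have [_ _ <-] := O_node e'.
Qed.

(** The sum is reindexed by the heads of the chain arcs; the top term vanishes since [N] is not a
    node. *)
Lemma sum_chain_out S T g1 g2 x X : defect_flow x S T g1 g2 ->
  \sum_(v < N | X v) g1 v.+1 = \sum_(v < N) ((0 < v) && X v.-1) * g1 v.
Proof.
move=> f.
have g1N : g1 N = 0.
  by apply/eqP/contraT => /(flow_g1 f)/C_node; rewrite ltnn andbF.
rewrite big_mkcond /= -(big_mkord xpredT (fun v => if X v then g1 v.+1 else 0)).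
rewrite -(big_mkord xpredT (fun v => ((0 < v) && X v.-1) * g1 v)).
transitivity (\sum_(0 <= v < N.+1) ((0 < v) && X v.-1) * g1 v).
  rewrite big_nat_recl //= add0n; apply: eq_bigr => v _.
  by case: (X v); rewrite ?mul1n.
by rewrite big_nat_recr //= g1N muln0 addn0.
Qed.

(** Every arc that starts in [X] ends in [X], so what leaves nodes of [X] is part of what enters
    them. *)
Lemma sum_flow_out_le S T g1 g2 X : flow S T g1 g2 -> arc_closed X ->
  \sum_(v < N | X v) (g1 v.+1 + cross_out g2 v) <= \sum_(v < N | X v) (g1 v + g2 v).
Proof.
move=> f [clC clO]; rewrite !big_split /=; apply: leq_add.
  rewrite (sum_chain_out _ f) [leqRHS]big_mkcond; apply: leq_sum => -[[|v] ltv] _ //=.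
  case Xv: (X v); rewrite ?mul1n //; case: ifP => // nX.
  case: (eqVneq (g1 v.+1) 0) => [->//|/(flow_g1 f)/clC].
  by rewrite nX Xv => /(_ isT).
rewrite (eq_bigr _ (fun (v : 'I_N) _ => cross_outE v f)).
rewrite [leqRHS](eq_bigr _ (fun (v : 'I_N) _ => cross_inE f (ltn_ord v))).
rewrite big_mkcond [leqRHS]big_mkcond /=.
rewrite (eq_bigr (fun v : 'I_N => \sum_(u < N) X v * ((O v == u.+1) * g2 u))); last first.
  by move=> v _; rewrite -big_distrr /=; case: (X v); rewrite ?mul1n ?mul0n.
rewrite [leqRHS](eq_bigr (fun u : 'I_N => \sum_(v < N) X u * ((O v == u.+1) * g2 u))); last first.
  by move=> v _; rewrite -big_distrr /=; case: (X v); rewrite ?mul1n ?mul0n.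
rewrite exchange_big /=; apply: leq_sum => u _; apply: leq_sum => v _.
case: eqP => [e|_]; last by rewrite mul0n !muln0.
by case Xv: (X v); rewrite // (clO _ _ e Xv).
Qed.

(** The mirror image: [X] is closed under cancelling arcs, so all flow entering a node of [X] comes
    from a node of [X]. *)
Lemma sum_flow_in_le S T g1 g2 X : flow S T g1 g2 ->
  (forall u, g1 u.+1 != 0 -> X u.+1 -> X u) -> (forall u, g2 u != 0 -> X u -> X (I u)) ->
  \sum_(v < N | X v) (g1 v + g2 v) <= \sum_(v < N | X v) (g1 v.+1 + cross_out g2 v).
Proof.
move=> f clC clO; rewrite !big_split /=; apply: leq_add.
  rewrite (sum_chain_out _ f) big_mkcond; apply: leq_sum => -[[|v] ltv] _ //=.
    case: (eqVneq (g1 0) 0) => [->|/(flow_g1 f)/C_node //]; by rewrite muln0 if_same.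
  case: ifP => // Xv; case: (eqVneq (g1 v.+1) 0) => [->//|/clC/(_ Xv)->].
  by rewrite mul1n.
rewrite [leqRHS](eq_bigr _ (fun (v : 'I_N) _ => cross_outE v f)).
rewrite (eq_bigr _ (fun (v : 'I_N) _ => cross_inE f (ltn_ord v))).
rewrite big_mkcond [leqRHS]big_mkcond /=.
rewrite [leqRHS](eq_bigr (fun v : 'I_N => \sum_(u < N) X v * ((O v == u.+1) * g2 u))); last first.
  by move=> v _; rewrite -big_distrr /=; case: (X v); rewrite ?mul1n ?mul0n.
rewrite (eq_bigr (fun u : 'I_N => \sum_(v < N) X u * ((O v == u.+1) * g2 u))); last first.
  by move=> v _; rewrite -big_distrr /=; case: (X v); rewrite ?mul1n ?mul0n.
rewrite [leqRHS]exchange_big /=; apply: leq_sum => u _; apply: leq_sum => v _.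
case: eqP => [e|_]; last by rewrite mul0n !muln0.
case: (eqVneq (g2 u) 0) => [->|nz]; first by rewrite !muln0.
by case Xu: (X u); rewrite //; have [_ _ <-] := O_node e; rewrite clO.
Qed.

Lemma sum_flow_eq S T g1 g2 X : flow S T g1 g2 ->
  \sum_(v < N | X v) S0 v + \sum_(v < N | X v) T v + \sum_(v < N | X v) (g1 v + g2 v) =
  \sum_(v < N | X v) T0 v + \sum_(v < N | X v) S v +
    \sum_(v < N | X v) (g1 v.+1 + cross_out g2 v).
Proof.
move=> f; rewrite -!big_split /=; apply: eq_bigr => v _.
have := flow_eq f (ltn_ord v); case: eqP => [e|_]; last by rewrite addn0.
by have := ltn_ord v; rewrite e ltnn.
Qed.

Lemma cutE X : cut X = \sum_(v < N | X v) T0 v + \sum_(v < N | ~~ X v) S0 v.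
Proof.
rewrite /cut (bigID (fun v : 'I_N => X v)) /=.
by congr (_ + _); apply: eq_bigr => v; [move=> ->|move/negbTE=> ->].
Qed.

Definition value S val := val + \sum_(v < N) S v = \sum_(v < N) S0 v.

(** Weak duality: by conservation, the supply used inside [X] is at most the demand there, and the
    supply used outside is at most all of it. *)
Lemma flow_le_cut S T g1 g2 X val :
  flow S T g1 g2 -> value S val -> arc_closed X -> val <= cut X.
Proof.
move=> f; rewrite /value (bigID (fun v : 'I_N => X v)) [RHS](bigID (fun v : 'I_N => X v)) /=.
move=> hv clX; have := sum_flow_eq X f; have := sum_flow_out_le f clX.
by rewrite cutE; move: hv; gen_sums; lia.
Qed.

(** The estimates of weak duality are reversed for a set reached by a failed search: supplies
    outside are exhausted, demands inside are saturated, and no flow enters from outside. *)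
Lemma stuck_flow_eq_cut S T g1 g2 X val : flow S T g1 g2 -> value S val ->
  (forall u, g1 u.+1 != 0 -> X u.+1 -> X u) -> (forall u, g2 u != 0 -> X u -> X (I u)) ->
  (forall v, S v != 0 -> X v) -> (forall v, X v -> T v = 0) -> val >= cut X.
Proof.
move=> f; rewrite /value (bigID (fun v : 'I_N => X v)) [RHS](bigID (fun v : 'I_N => X v)) /=.
move=> hv c1 c2 hS hT; have := sum_flow_eq X f; have := sum_flow_in_le f c1 c2.
have -> : \sum_(v < N | X v) T v = 0 by rewrite big1 // => v /hT.
have e0 : \sum_(v < N | ~~ X v) S v = 0.
  by rewrite big1 // => v nX; apply/eqP/contraT => /hS; rewrite (negbTE nX).
by rewrite cutE; move: hv; rewrite e0; gen_sums; lia.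
Qed.

(* Kinds 1 and 2 follow a chain or cross arc from [v] to [u]; kinds 3 and 4 cancel flow on such an arc from
   [u] to [v]. *)
Definition residual g1 g2 (kind v u : nat) : bool :=
  match kind with
  | 1 => (u == v.+1) && (C u != 0)
  | 2 => O v == u.+1
  | 3 => (v == u.+1) && (g1 v != 0)
  | 4 => (u == I v) && (g2 v != 0)
  | _ => false
  end.

Definition push1 g1 (kind v u : nat) : nat -> nat :=
  match kind with 1 => upd g1 u (g1 u).+1 | 3 => upd g1 v (g1 v).-1 | _ => g1 end.

Definition push2 g2 (kind v u : nat) : nat -> nat :=
  match kind with 2 => upd g2 u (g2 u).+1 | 4 => upd g2 v (g2 v).-1 | _ => g2 end.

(** Paths are augmented backwards. Spending the demand at the end of the path unbalances that node
    by one; each push moves the defect one arc closer to the root, where spending a supply removes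
    it. *)
Lemma flow_start x S T g1 g2 : flow S T g1 g2 -> T x != 0 ->
  defect_flow x S (upd T x 0) g1 g2.
Proof.
move=> f Tx; split=> [v ltv|v|v|u|u]; rewrite /upd.
- have := flow_eq f ltv; have := flow_T f x.
  case: (eqVneq v N) => [e|_]; first by rewrite e ltnn in ltv.
  by case: eqP => [->|_]; lia.
- exact: flow_S f v.
- by case: eqP => // _; apply: flow_T f v.
- exact: flow_g1 f u.
- exact: flow_g2 f u.
Qed.

Lemma flow_end x S T g1 g2 : defect_flow x S T g1 g2 -> S x != 0 ->
  flow (upd S x 0) T g1 g2.
Proof.
move=> f Sx; split=> [v ltv|v|v|u|u]; rewrite /upd.
- have := flow_eq f ltv; have := flow_S f x.
  case: (eqVneq v N) => [e|_]; first by rewrite e ltnn in ltv.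
  by case: eqP => [->|_]; lia.
- by case: eqP => // _; apply: flow_S f v.
- exact: flow_T f v.
- exact: flow_g1 f u.
- exact: flow_g2 f u.
Qed.

Lemma cross_out_upd g2 v u y x : O v = u.+1 ->
  cross_out (upd g2 u y) x = if x == v then y else cross_out g2 x.
Proof.
move=> e; rewrite /cross_out /upd; case: (eqVneq x v) => [->|nx]; first by rewrite e eqxx.
case E: (O x) => [//|w]; case: eqP => // ew; case/eqP: nx.
by have [_ _ <-] := O_node E; have [_ _ <-] := O_node e; rewrite ew.
Qed.

Lemma flow_push kind v u S T g1 g2 : defect_flow u S T g1 g2 -> residual g1 g2 kind v u ->
  defect_flow v S T (push1 g1 kind v u) (push2 g2 kind v u).
Proof.
move=> f; case: kind => [|[|[|[|[|kind]]]]] //= =>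
  [/andP[/eqP eu Cu]|/eqP e|/andP[/eqP ev nz]|/andP[/eqP eu nz]].
- split=> [x ltx|x|x|x|x]; rewrite /upd; try by case: f; auto.
    have := flow_eq f ltx; rewrite eu eqSS.
    by case: (x =P v.+1) => [->|_]; rewrite ?eqxx; [case: (_ =P v)|case: (x =P v) => [->|_]]; lia.
  by case: (x =P u) => [->//|_]; apply: flow_g1 f x.
- split=> [x ltx|x|x|x|x]; try by case: f; auto.
    have := flow_eq f ltx; rewrite (cross_out_upd _ _ _ e) /upd.
    have -> : cross_out g2 x = if x == v then g2 u else cross_out g2 x.
      by case: eqP => // ->; rewrite /cross_out e.
    by case: (x =P u) => [->|_]; rewrite ?eqxx; case: (_ =P v); lia.
  rewrite /upd; case: (x =P u) => [-> _|_]; last exact: flow_g2 f x.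
  by have [_ _ ->] := O_node e.
- split=> [x ltx|x|x|x|x]; rewrite /upd; try by case: f; auto.
    have := flow_eq f ltx; move: nz; rewrite ev eqSS.
    by case: (x =P u.+1) => [->|_]; rewrite ?eqxx; [case: (_ =P u)|case: (x =P u) => [->|_]]; lia.
  by case: (x =P v) => [-> _|_ h]; apply: (flow_g1 f).
- have e := flow_g2 f nz; rewrite -eu in e.
  split=> [x ltx|x|x|x|x]; try by case: f; auto.
    have := flow_eq f ltx; rewrite (cross_out_upd _ _ _ e) /upd.
    have -> : cross_out g2 x = if x == u then g2 v else cross_out g2 x.
      by case: eqP => // ->; rewrite /cross_out e.
    by move: nz; case: (x =P v) => [->|_]; rewrite ?eqxx; case: (_ =P u); lia.
  by rewrite /upd; case: (x =P v) => [-> _|_ h]; apply: (flow_g2 f).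
Qed.

End Flow.

(** * A loop language and its compilation *)

Section Execution.
Variable prog : seq instr.
Implicit Types (pc t : nat) (M : memory) (c : seq instr) (Q : memory -> Prop).

(** Quantifying over the remaining fuel lets code fragments compose without any mention of
    halting. *)
Definition goes b pc M pc' Q : Prop :=
  exists t M', [/\ t <= b, forall f, run prog (t + f) pc M = run prog f pc' M' & Q M'].

Lemma goes_refl b pc M Q : Q M -> goes b pc M pc Q.
Proof. by move=> q; exists 0, M. Qed.

Lemma goes_trans b1 b2 b pc M pc1 pc2 Q1 Q2 : b1 + b2 <= b ->
  goes b1 pc M pc1 Q1 -> (forall M1, Q1 M1 -> goes b2 pc1 M1 pc2 Q2) ->
  goes b pc M pc2 Q2.
Proof.
move=> leb [t1 [M1 [le1 r1 q1]]] /(_ _ q1) [t2 [M2 [le2 r2 q2]]].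
by exists (t1 + t2), M2; split=> // [|f]; [lia|rewrite -addnA r1 r2].
Qed.

Lemma goes_weaken b b' pc M pc' Q Q' : b <= b' -> (forall M', Q M' -> Q' M') ->
  goes b pc M pc' Q -> goes b' pc M pc' Q'.
Proof. by move=> le QQ [t [M' [le' r q]]]; exists t, M'; split; [lia| |apply: QQ]. Qed.

Definition is_halt i := if i is IHalt then true else false.

Lemma goes_step b pc M pc' Q i : nth IHalt prog pc = i -> ~~ is_halt i ->
  goes b (step i pc M).1 (step i pc M).2 pc' Q -> goes b.+1 pc M pc' Q.
Proof.
move=> e h [t [M' [le r q]]]; exists t.+1, M'; split=> // f.
by rewrite -r addSn /= e; case: i {e} h r => //= *; case: ifP.
Qed.

Definition code_at pc c := forall i, i < size c -> nth IHalt prog (pc + i) = nth IHalt c i.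

Lemma code_at_cat pc c1 c2 :
  code_at pc (c1 ++ c2) <-> code_at pc c1 /\ code_at (pc + size c1) c2.
Proof.
split=> [h|[h1 h2] i]; last first.
  rewrite size_cat nth_cat => lt; case: ltnP => [/h1//|ge].
  by rewrite -h2; [congr nth; lia|lia].
split=> i lt.
  by rewrite h ?nth_cat ?lt // size_cat; lia.
rewrite -addnA h ?size_cat ?ltn_add2l // nth_cat ltnNge leq_addr /=.
by congr nth; lia.
Qed.

Lemma code_at_cons pc i c : code_at pc (i :: c) <-> nth IHalt prog pc = i /\ code_at pc.+1 c.
Proof.
rewrite -cat1s code_at_cat addn1; split=> -[h1 h2]; split=> //.
  by have := h1 0 isT; rewrite addn0.
by case=> // _; rewrite addn0.
Qed.

Definition straight i := match i with IJz _ _ | IJmp _ | IHalt => false | _ => true end.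

(** The effect of straight-line code on memory does not depend on the program counter, so 0 stands
    in for it. *)
Definition exec c M := foldl (fun M i => (step i 0 M).2) M c.

Lemma exec_cat c1 c2 M : exec (c1 ++ c2) M = exec c2 (exec c1 M).
Proof. exact: foldl_cat. Qed.

Lemma exec1 i M : exec [:: i] M = (step i 0 M).2.
Proof. by []. Qed.

Lemma goes_exec c pc M : code_at pc c -> all straight c ->
  goes (size c) pc M (pc + size c) (fun M' => M' = exec c M).
Proof.
elim: c pc M => [|i c IH] pc M /=; first by move=> _ _; rewrite addn0; apply: goes_refl.
move=> /code_at_cons[e h] /andP[si sc]; apply: (goes_step e); first by case: i si {e}.
have -> : (step i pc M).1 = pc.+1 by case: i si {e}.
have -> : (step i pc M).2 = (step i 0 M).2 by case: i si {e}.
by rewrite addnS -addSn; apply: IH.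
Qed.

End Execution.

#[local] Arguments exec : simpl never.

(* Sixteen infinite arrays; array 0 holds the scalar variables. *)
Definition state := nat -> nat -> nat.

Definition put (s : state) k i v : state :=
  fun k' i' => if (k' == k) && (i' == i) then v else s k' i'.

Inductive expr :=
  | EC of nat
  | EA of nat & expr
  | EAdd of expr & expr
  | ESub of expr & expr.

Inductive cmd :=
  | CSkip
  | CPut of nat & expr & expr
  | CSeq of cmd & cmd
  | CIf of expr & cmd & cmd
  | CLoop of cmd.

Fixpoint eval (s : state) e :=
  match e with
  | EC n => n
  | EA k e => s k (eval s e)
  | EAdd a b => eval s a + eval s b
  | ESub a b => eval s a - eval s b
  end.

(* Every loop runs exactly [F] times, so that the running time depends only on the nesting depth. *)
Fixpoint sem F c (s : state) : state :=
  match c with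
  | CSkip => s
  | CPut k i e => put s k (eval s i) (eval s e)
  | CSeq a b => sem F b (sem F a s)
  | CIf e a b => if eval s e == 0 then sem F b s else sem F a s
  | CLoop a => iter F (sem F a) s
  end.

(* Cell [i] of array [k] lives at address [F + 16 * i + k], and the RAM cell 1 contains [F]. *)
Definition addr d k := [:: IAdd d d d; IAdd d d d; IAdd d d d; IAdd d d d; IAdd d d 1;
  IConst d.+1 k; IAdd d d d.+1].

Lemma size_addr d k : size (addr d k) = 7. Proof. by []. Qed.

Lemma straight_addr d k : all straight (addr d k). Proof. by []. Qed.

Lemma exec_addr F d k M : 1 < d -> M 1 = F ->
  exec (addr d k) M d = F + 16 * M d + k /\
  forall a, (a < d) || (d.+1 < a) -> exec (addr d k) M a = M a.
Proof.
move=> ltd e; rewrite /exec /= /upd.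
have [n1 n2 n3] : [/\ (d == d.+1) = false, (1 == d) = false & (d.+1 == d) = false] by split; lia.
rewrite !eqxx n1 n2 e; split; first lia.
by move=> a lt; have [-> ->] : (a == d) = false /\ (a == d.+1) = false by split; lia.
Qed.

#[local] Opaque addr.

(** The scratch cells form a stack: the value is left in cell [d], and only cells from [d] on are
    overwritten. *)
Fixpoint cexpr d e : seq instr :=
  match e with
  | EC n => [:: IConst d n]
  | EA k e => cexpr d e ++ addr d k ++ [:: ILoad d d]
  | EAdd a b => cexpr d a ++ cexpr d.+1 b ++ [:: IAdd d d d.+1]
  | ESub a b => cexpr d a ++ cexpr d.+1 b ++ [:: ISub d d d.+1]
  end.

(** Cell 1 holds [F], cells 2 to 7 the counters of nested loops, cells 8 to 15 the expression stack;
    [lv] is the number of enclosing loops. Jump targets are absolute, hence the argument [pc]. *)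
Fixpoint compile lv pc c : seq instr :=
  match c with
  | CSkip => [::]
  | CPut k i e => cexpr 8 i ++ addr 8 k ++ cexpr 9 e ++ [:: IStore 8 9]
  | CSeq a b => let ca := compile lv pc a in ca ++ compile lv (pc + size ca) b
  | CIf e a b =>
      let ce := cexpr 8 e in
      let pa := (pc + size ce).+1 in
      let ca := compile lv pa a in
      let pb := (pa + size ca).+1 in
      let cb := compile lv pb b in
      ce ++ IJz 8 pb :: ca ++ IJmp (pb + size cb) :: cb
  | CLoop a =>
      let ca := compile lv.+1 (pc + 3) a in
      [:: IConst lv.+2 0; IAdd lv.+2 lv.+2 1; IJz lv.+2 (pc + size ca + 6)] ++
      ca ++ [:: IConst 8 1; ISub lv.+2 lv.+2 8; IJmp (pc + 2)]
  end.

(** An array access takes at least two cells because [addr] uses the next one as scratch. *)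
Fixpoint cells e :=
  match e with
  | EC _ => 1
  | EA _ e => maxn (cells e) 2
  | EAdd a b | ESub a b => maxn (cells a) (cells b).+1
  end.

Fixpoint ewf e :=
  match e with
  | EC _ => true
  | EA k e => (k < 16) && ewf e
  | EAdd a b | ESub a b => ewf a && ewf b
  end.

Fixpoint depth c :=
  match c with
  | CSkip | CPut _ _ _ => 0
  | CSeq a b | CIf _ a b => maxn (depth a) (depth b)
  | CLoop a => (depth a).+1
  end.

(** The value to be stored is computed from cell 9 on, above the target address in cell 8, which
    leaves seven cells. *)
Fixpoint cwf c :=
  match c with
  | CSkip => true
  | CPut k i e => [&& k < 16, ewf i, ewf e, cells i <= 8 & cells e <= 7]
  | CSeq a b => cwf a && cwf b
  | CIf e a b => [&& ewf e, cells e <= 8, cwf a & cwf b]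
  | CLoop a => cwf a
  end.

Fixpoint time F c :=
  match c with
  | CSkip => 0
  | CPut k i e => size (cexpr 8 i) + size (cexpr 9 e) + 8
  | CSeq a b => time F a + time F b
  | CIf e a b => size (cexpr 8 e) + 2 + time F a + time F b
  | CLoop a => 3 + F * (time F a + 4)
  end.

Definition rep F (M : memory) (s : state) : Prop :=
  [/\ 16 <= F, M 1 = F & forall k i, k < 16 -> M (F + 16 * i + k) = s k i].

Lemma rep_ext F M M' s : rep F M s -> (forall a, a = 1 \/ 16 <= a -> M' a = M a) -> rep F M' s.
Proof.
by move=> [leF e h] eM; split=> // [|k i ltk]; rewrite eM //; [left|rewrite h|right; lia].
Qed.

Lemma straight_cexpr d e : all straight (cexpr d e).
Proof.
by elim: e d => //= [k e IH|a IHa b IHb|a IHa b IHb] d;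
  rewrite !all_cat ?straight_addr ?IH ?IHa ?IHb.
Qed.

Lemma exec_cexpr F d e M s : ewf e -> rep F M s -> 1 < d -> d + cells e <= 16 ->
  exec (cexpr d e) M d = eval s e /\
  forall a, (a < d) || (16 <= a) -> exec (cexpr d e) M a = M a.
Proof.
elim: e d M => [n|k e IH|a IHa b IHb|a IHa b IHb] d M /=.
- move=> _ _ _ le; rewrite /exec /= /upd eqxx; split=> // a lt.
  by case: eqP => //; lia.
- move=> /andP[ltk we] r ltd le; have [v o] := IH d M we r ltd ltac:(lia).
  rewrite !exec_cat exec1 /=; set M1 := exec (cexpr d e) M in v o *.
  have [|v2 o2] := @exec_addr F d k M1 ltd; first by rewrite o ?ltd //; case: r.
  rewrite /upd eqxx v2 v; split=> [|a lta].
    case: r => leF _ h; rewrite o2; last by lia.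
    by rewrite o ?h //; lia.
  have -> : (a == d) = false by lia.
  by rewrite o2 ?o //; lia.
all: move=> /andP[wa wb] r ltd le; have [v o] := IHa d M wa r ltd ltac:(lia).
all: rewrite !exec_cat exec1 /=; set M1 := exec (cexpr d a) M in v o *.
all: have r1 : rep F M1 s by apply: rep_ext r _ => x lx; apply: o; lia.
all: have [v2 o2] := IHb d.+1 M1 wb r1 ltac:(lia) ltac:(lia).
all: rewrite /upd eqxx v2 o2 ?v ?ltnSn //; split=> // x lx.
all: by have -> : (x == d) = false by [lia]; rewrite o2 ?o //; lia.
Qed.

Section Compilation.
Variables (prog : seq instr) (F : nat).

(** The clause on cells 2 to [lv.+1] strengthens the induction: a body must preserve the counters of
    the loops around it. *)
Lemma comp_correct c lv pc M s : cwf c -> lv + depth c <= 6 ->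
  code_at prog pc (compile lv pc c) -> rep F M s ->
  goes prog (time F c) pc M (pc + size (compile lv pc c))
    (fun M' => rep F M' (sem F c s) /\ forall a, 1 < a < lv.+2 -> M' a = M a).
Proof.
elim: c lv pc M s => [|k i e|a IHa b IHb|e a IHa b IHb|a IHa] lv pc M s /=.
- by rewrite !addn0 => _ _ _ r; apply: goes_refl; split.
- case/and5P=> ltk wi we ci ce lelv hc r.
  apply: goes_weaken (goes_exec M hc _) => [||]; last 1 first.
  + by rewrite !all_cat straight_addr !straight_cexpr.
  + by rewrite !size_cat size_addr /=; lia.
  move=> _ ->; have [v o] := exec_cexpr wi r (isT : 1 < 8) ltac:(lia).
  rewrite !exec_cat exec1 /=; set M1 := exec (cexpr 8 i) M in v o *.
  have r1 : rep F M1 s by apply: rep_ext r _ => x lx; apply: o; lia.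
  have [|v2 o2] := @exec_addr F 8 k M1 isT; first by case: r1.
  set M2 := exec (addr 8 k) M1 in v2 o2 *.
  have r2 : rep F M2 s by apply: rep_ext r1 _ => x lx; apply: o2; lia.
  have [v3 o3] := exec_cexpr we r2 (isT : 1 < 9) ltac:(lia).
  set M3 := exec (cexpr 9 e) M2 in v3 o3 *.
  rewrite v3 o3 // v2 v; split.
    have [leF e1 h] := r2; split=> // [|k' i' ltk']; rewrite /upd.
      by have -> : (1 == F + 16 * eval s i + k) = false by [lia]; rewrite o3.
    rewrite /put; case: ifP => [/eqP e'|ne].
      have [-> ->] : k' = k /\ i' = eval s i by lia.
      by rewrite !eqxx.
    rewrite o3 ?h //; last lia.
    by case: ifP => // /andP[/eqP ek /eqP ei]; move: ne; rewrite ek ei eqxx.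
  move=> x /andP[lx1 lx2]; case: r => leF _ _.
  rewrite /upd; have -> : (x == F + 16 * eval s i + k) = false by lia.
  by rewrite o3 ?o2 ?o //; lia.
- case/andP=> wa wb le /code_at_cat[ha hb] r; rewrite size_cat addnA.
  apply: goes_trans (leqnn _) (IHa _ _ _ _ wa _ ha r) _; first lia.
  move=> M1 [r1 o1]; apply: goes_weaken (leqnn _) _ (IHb _ _ _ _ wb _ hb r1); last lia.
  by move=> M2 [r2 o2]; split=> // x lx; rewrite o2 ?o1.
- case/and4P=> we ce wa wb le /code_at_cat[he /code_at_cons[hj]].
  rewrite -addSn => /code_at_cat[ha /code_at_cons[hj2 hb]] r.
  have := goes_exec M he (straight_cexpr _ _).
  have [v o] := exec_cexpr we r (isT : 1 < 8) ltac:(lia) => g.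
  apply: goes_trans g _; last first.
    move=> _ ->; set M1 := exec _ M in v o *.
    have r1 : rep F M1 s by apply: rep_ext r _ => x lx; apply: o; lia.
    apply: (goes_step hj) => //=; rewrite v; case: eqP => ez.
      set pb := (_ + size (compile _ _ a)).+1.
      rewrite !size_cat /= size_cat /=.
      have -> : pc + (size (cexpr 8 e) + (size (compile lv (pc + size (cexpr 8 e)).+1 a) +
        (size (compile lv pb b)).+1).+1) = pb + size (compile lv pb b) by rewrite /pb; lia.
      apply: goes_weaken (leq_addr (time F a).+1 _) _ (IHb _ _ _ _ wb _ hb r1); last lia.
      by move=> M2 [r2 o2]; split=> // x lx; rewrite o2 ?o //; lia.
    apply: goes_trans (IHa _ _ _ _ wa _ ha r1) _; [|lia|]; last first.
      move=> M2 [r2 o2]; apply: (goes_step hj2) => //=.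
      rewrite !size_cat /= size_cat /=.
      set x := (_ + size (compile _ _ b)); set y := pc + _; have -> : x = y by rewrite /x /y; lia.
      apply: (@goes_refl _ (time F b)); split=> // z lz; rewrite o2 ?o //; lia.
    by lia.
  by lia.
- move=> wa le.
  set ca := compile lv.+1 (pc + 3) a; set e := pc + size ca + 6.
  move=> /code_at_cons[h1 /code_at_cons[h2 /code_at_cons[h3]]].
  have -> : pc.+3 = pc + 3 by lia.
  case/code_at_cat => ha /code_at_cons[h4 /code_at_cons[h5 /code_at_cons[h6 _]]] r.
  have -> : pc + (size (ca ++ [:: IConst 8 1; ISub lv.+2 lv.+2 8; IJmp (pc + 2)])).+3 = e.
    by rewrite size_cat /= /e; lia.
  (* Execution from the loop test on, with [j] rounds left; the extra step is the final test. *)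
  have loop j M1 s1 : M1 lv.+2 = j -> rep F M1 s1 ->
    goes prog (j * (time F a + 4)).+1 (pc + 2) M1 e
      (fun M' => rep F M' (iter j (sem F a) s1) /\ forall x, 1 < x < lv.+2 -> M' x = M1 x).
    elim: j M1 s1 => [|j IH] M1 s1 ej r1.
      apply: (goes_step (i := IJz lv.+2 e)) => //=; first by rewrite addn2.
      by rewrite ej /=; apply: goes_refl.
    apply: (goes_step (i := IJz lv.+2 e)) => //=; first by rewrite addn2.
    rewrite ej /= -addnS.
    have lelv : lv.+1 + depth a <= 6 by lia.
    apply: goes_trans (IHa _ _ _ _ wa lelv ha r1) _; last first.
      move=> M2 [r2 o2].
      apply: (goes_step h4) => //=; apply: (goes_step h5) => //=; apply: (goes_step h6) => //=.
      set M3 := upd _ _ _.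
      have o3 x : x != 8 -> x != lv.+2 -> M3 x = M2 x.
        by rewrite /M3 /upd => /negbTE-> /negbTE->.
      have r3 : rep F M3 (sem F a s1) by apply: rep_ext r2 _ => x lx; apply: o3; lia.
      have e3 : M3 lv.+2 = j.
        rewrite /M3 /upd !eqxx; have -> : (lv.+2 == 8) = false by lia.
        by rewrite o2 ?ej; lia.
      apply: goes_weaken (leqnn _) _ (IH M3 _ e3 r3) => M4 [r4 o4].
      rewrite -iterS iterSr; split=> // x lx; rewrite o4 // o3 ?o2 //; lia.
    lia.
  have [leF eF _] := r; rewrite addSn.
  apply: (goes_step h1) => //=; rewrite addSn.
  apply: (goes_step h2) => //=; rewrite addSn add0n -[pc.+2]addn2.
  rewrite /upd !eqxx /=; set M1 := (fun _ => _).
  have e1 : M1 lv.+2 = F by rewrite /M1 eqxx eF.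
  have o1 x : x != lv.+2 -> M1 x = M x by rewrite /M1 => /negbTE->.
  have r1 : rep F M1 s by apply: rep_ext r _ => x lx; apply: o1; lia.
  apply: goes_weaken _ _ (loop _ _ _ e1 r1) => [|M2 [r2 o2]]; first by lia.
  by split=> // x lx; rewrite o2 // o1 //; lia.
Qed.

(** This is [time] at [F = 1]. *)
Fixpoint tconst c :=
  match c with
  | CSkip => 0
  | CPut k i e => size (cexpr 8 i) + size (cexpr 9 e) + 8
  | CSeq a b => tconst a + tconst b
  | CIf e a b => size (cexpr 8 e) + 2 + tconst a + tconst b
  | CLoop a => 3 + (tconst a + 4)
  end.

Lemma time_le c : 0 < F -> time F c <= tconst c * F ^ depth c.
Proof.
move=> F0; have p1 k : 0 < F ^ k by rewrite expn_gt0 F0.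
elim: c => [|k i e|a IHa b IHb|e a IHa b IHb|a IHa] //=; first by rewrite expn0 muln1.
- rewrite mulnDl; apply: leq_add; [apply: leq_trans IHa _|apply: leq_trans IHb _].
    by rewrite leq_mul2l leq_pexp2l ?leq_maxl ?orbT.
  by rewrite leq_mul2l leq_pexp2l ?leq_maxr ?orbT.
- have h k : k <= k * F ^ maxn (depth a) (depth b) by rewrite leq_pmulr.
  rewrite !mulnDl; apply: leq_add; [apply: leq_add; [exact: leq_add|apply: leq_trans IHa _]|
    apply: leq_trans IHb _].
    by rewrite leq_mul2l leq_pexp2l ?leq_maxl ?orbT.
  by rewrite leq_mul2l leq_pexp2l ?leq_maxr ?orbT.
- rewrite mulnDl; apply: leq_add; first by rewrite leq_pmulr.
  rewrite expnS mulnCA leq_mul2l mulnDl; apply/orP; right; apply: leq_add => //.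
  by rewrite leq_pmulr.
Qed.

End Compilation.

(** * Making room in the input *)

Section Prelude.
Variable prog : seq instr.

Lemma goes_straight c pc M (Q : memory -> Prop) :
  code_at prog pc c -> all straight c -> Q (exec c M) -> goes prog (size c) pc M (pc + size c) Q.
Proof. by move=> h s q; apply: goes_weaken (leqnn _) _ (goes_exec M h s) => _ ->. Qed.

(** Adding four times each of [n], ..., 1 yields [2 * (n * n.+1)] without multiplication, but counts
    [n] down to 0. *)
Definition sum_loop pc := [:: IAdd 1 1 0; IAdd 1 1 0; IAdd 1 1 0; IAdd 1 1 0; ISub 0 0 2;
  IJz 0 (pc + 7); IJmp pc].

Lemma sum_loop_correct pc k M : code_at prog pc (sum_loop pc) -> M 2 = 1 -> M 0 = k.+1 ->
  goes prog (7 * k.+1) pc M (pc + 7) (fun M' =>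
    [/\ M' 0 = 0, M' 1 = M 1 + 2 * (k.+1 * k.+2) & forall a, 1 < a -> M' a = M a]).
Proof.
move=> hc; elim: k M => [|k IH] M e2 e0.
all: move: (hc); do 7![case/code_at_cons; let h := fresh "h" in move=> h]; move=> _.
  rewrite muln1; apply: (goes_step h) => //; apply: (goes_step h0) => //.
  apply: (goes_step h1) => //; apply: (goes_step h2) => //; apply: (goes_step h3) => //.
  apply: (goes_step h4) => //=; rewrite /upd /= e0 e2 /=.
  apply: goes_refl; split=> //=; first lia.
  by case=> [|[|a]].
rewrite mulnS; apply: (goes_step h) => //; apply: (goes_step h0) => //.
apply: (goes_step h1) => //; apply: (goes_step h2) => //; apply: (goes_step h3) => //.
apply: (goes_step h4) => //=; rewrite {2}/upd /= /upd /= e0 e2 /=.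
apply: (goes_step h5) => //=.
set M1 := (fun _ => _); apply: goes_weaken (leqnn _) _ (IH M1 e2 erefl) => M' [q0 q1 q2].
split=> //; first by rewrite q1 /M1 /=; lia.
by case=> [|[|a]] // lta; rewrite q2.
Qed.

(** To recover [n], the terms 4, 8, 12, ... are subtracted until nothing is left, and the
    subtractions are counted in cell 0. Cell 2 being the only scratch, the remainder lives in cell
    [F]. *)
Definition unsum_loop pc := [:: IConst 2 1; IAdd 0 0 2; ILoad 2 1; ISub 2 2 0; ISub 2 2 0;
  ISub 2 2 0; ISub 2 2 0; IStore 1 2; IJz 2 (pc + 10); IJmp pc].

(** After [k] subtractions, with [d.+1] to come, the remainder is the sum of [4 * i] over
    [k < i <= k + d.+1]. *)
Lemma unsum_loop_correct pc k d F M : code_at prog pc (unsum_loop pc) -> 16 <= F ->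
  M 1 = F -> M 0 = k -> M F = 2 * (d.+1 * d.+1 + 2 * (k * d.+1) + d.+1) ->
  goes prog (10 * d.+1) pc M (pc + 10) (fun M' =>
    M' 0 = k + d.+1 /\ forall a, a != 0 -> a != 2 -> a != F -> M' a = M a).
Proof.
move=> hc leF; elim: d k M => [|d IH] k M e1 e0 eF.
all: move: (hc); do 10![case/code_at_cons; let h := fresh "h" in move=> h]; move=> _.
all: rewrite ?muln1 ?(mulnS 10); apply: (goes_step h) => //; apply: (goes_step h0) => //.
all: apply: (goes_step h1) => //; apply: (goes_step h2) => //; apply: (goes_step h3) => //.
all: apply: (goes_step h4) => //; apply: (goes_step h5) => //; apply: (goes_step h6) => //.
all: apply: (goes_step h7) => //=; rewrite {2}/upd /=.
all: set M1 := upd _ _ _.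
all: have [n0 n2] : (F == 0) = false /\ (F == 2) = false by split; lia.
all: have [n0' n2'] : (0 == F) = false /\ (2 == F) = false by split; lia.
all: have n1 : (1 == F) = false by lia.
all: have z1 : M1 1 = F by rewrite /M1 /upd /= !e1 n1.
all: have z0 : M1 0 = k.+1 by rewrite /M1 /upd /= !e1 e0 n0' addn1.
all: have zF : M1 F = M F - 4 * k.+1 by rewrite /M1 /upd /= !e1 eqxx n0 n2 e0; lia.
all: have z2 : M1 2 = M1 F by rewrite /M1 /upd /= !e1 eqxx n2'.
all: have zo a : a != 0 -> a != 2 -> a != F -> M1 a = M a
  by rewrite /M1 /upd /= !e1 => /negbTE-> /negbTE-> /negbTE->.
all: move: M1 z1 z0 zF z2 zo => M1 z1 z0 zF z2 zo.
  have -> : M1 2 == 0 by rewrite z2 zF eF; lia.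
  by apply: goes_refl; split=> //; lia.
have -> : M1 2 == 0 = false by rewrite z2 zF eF; lia.
apply: (goes_step h8) => //=.
apply: goes_weaken _ _ (IH k.+1 M1 z1 z0 _); [lia| |by rewrite zF eF; lia].
by move=> M' [q0 qo]; split=> [|a x y z]; [lia|rewrite qo // zo].
Qed.

(** The low cells are moved one by one, through cell 2 alone, because the copy loop needs them as
    registers. The target is cell [i] of array 1. *)
Definition save_cells r := flatten [seq [:: IConst 2 (16 * i + 1); IAdd 2 2 1; IStore 2 i] | i <- r].

Lemma exec_save r M F : 16 <= F -> M 1 = F -> all (fun i => 2 < i < 16) r ->
  let M' := exec (save_cells r) M in
  [/\ forall a, a < F -> a != 2 -> M' a = M a,
      forall i, i \in r -> M' (F + 16 * i + 1) = M i
    & forall a, F <= a -> (forall i, i \in r -> a != F + 16 * i + 1) -> M' a = M a].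
Proof.
move=> leF; elim: r M => [|i r IH] M e1 /=; first by [].
move=> /andP[lti lr]; rewrite /exec /= -/(exec _ _) -/(save_cells r).
set M1 := upd _ _ _.
have eM1 a : M1 a = if a == F + 16 * i + 1 then M i else if a == 2 then F + 16 * i + 1 else M a.
  rewrite /M1 /upd /= e1; have -> : 16 * i + 1 + F = F + 16 * i + 1 by lia.
  have -> : (i == 2) = false by lia.
  by case: (a =P 2) => // ->; case: eqP => //; lia.
have [|h1 h2 h3] := IH M1 _ lr; first by rewrite eM1 /= e1; case: eqP => //; lia.
split.
- move=> a lta na; rewrite h1 // eM1 (negbTE na); case: eqP => //; lia.
- move=> j; rewrite inE; case: (boolP (j \in r)) => [jr _|njr].
    have := allP lr j jr => /andP[l1 l2].
    rewrite h2 // eM1; do 2?case: eqP; lia.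
  rewrite orbF => /eqP ej; rewrite h3; last 1 first.
  + move=> j' j'r; apply/eqP => e; case/negP: njr.
    by have -> : j = j' by lia.
  + by rewrite ej eM1 eqxx.
  by lia.
- move=> a lea ha; rewrite h3 //; last by move=> j jr; apply: ha; rewrite inE jr orbT.
  rewrite eM1 (negbTE (ha i _)) ?inE ?eqxx //; case: eqP => //; lia.
Qed.

(** Cells 3 and 4 point to source and target, cell 5 counts down, cells 6 and 7 hold the strides 1
    and 16. Sources lie below [F] and targets above, so nothing is overwritten before it is read. *)
Definition copy_loop pc := [:: IJz 5 (pc + 7); ILoad 8 3; IStore 4 8; IAdd 3 3 6; IAdd 4 4 7;
  ISub 5 5 6; IJmp pc].

Lemma copy_loop_correct pc F j M : code_at prog pc (copy_loop pc) -> 16 <= F -> M 1 = F ->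
  M 3 + j = F -> 16 <= M 3 -> M 4 = F + 16 * M 3 + 1 -> M 5 = j -> M 6 = 1 -> M 7 = 16 ->
  goes prog (7 * j).+1 pc M (pc + 7) (fun M' =>
    [/\ M' 1 = F, forall i, M 3 <= i < F -> M' (F + 16 * i + 1) = M i
      & forall a, F <= a -> (forall i, M 3 <= i -> a != F + 16 * i + 1) -> M' a = M a]).
Proof.
move=> hc leF; elim: j M => [|j IH] M e1 e3 l3 e4 e5 e6 e7.
all: move: (hc); do 7![case/code_at_cons; let h := fresh "h" in move=> h]; move=> _.
  apply: (goes_step h) => //=; rewrite e5 /=; apply: goes_refl; split=> // i; lia.
rewrite mulnS; apply: (goes_step h) => //=; rewrite e5 /=.
apply: (goes_step h0) => //; apply: (goes_step h1) => //; apply: (goes_step h2) => //.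
apply: (goes_step h3) => //; apply: (goes_step h4) => //; apply: (goes_step h5) => //=.
set M1 := upd _ _ _.
have eM1 a : M1 a = if a == 5 then M 5 - 1 else if a == 4 then M 4 + 16 else
  if a == 3 then M 3 + 1 else if a == M 4 then M (M 3) else if a == 8 then M (M 3) else M a.
  rewrite /M1 /upd /= e6 e7 e4.
  have -> : (3 == F + 16 * M 3 + 1) = false by lia.
  have -> : (4 == F + 16 * M 3 + 1) = false by lia.
  have -> : (5 == F + 16 * M 3 + 1) = false by lia.
  have -> : (6 == F + 16 * M 3 + 1) = false by lia.
  have -> : (7 == F + 16 * M 3 + 1) = false by lia.
  by [].
clearbody M1.
have f1 : M1 1 = F by rewrite eM1 /= e4 e1; case: eqP; lia.
have f3 : M1 3 = (M 3).+1 by rewrite eM1 /=; lia.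
have f4 : M1 4 = F + 16 * M1 3 + 1 by rewrite f3 eM1 /= e4; lia.
have f5 : M1 5 = j by rewrite eM1 /= e5; lia.
have f6 : M1 6 = 1 by rewrite eM1 /= e4; case: eqP; lia.
have f7 : M1 7 = 16 by rewrite eM1 /= e4; case: eqP; lia.
have f9 a : 8 < a -> a != F + 16 * M 3 + 1 -> M1 a = M a.
  move=> la na; rewrite eM1 e4 (negbTE na); do 4?case: eqP => //; lia.
have fc : M1 (F + 16 * M 3 + 1) = M (M 3).
  by rewrite eM1 e4 eqxx; do 3?case: eqP => //; lia.
apply: goes_weaken _ _ (IH M1 f1 _ _ f4 f5 f6 f7); [lia| |lia|lia].
move=> M' [g1 g2 g3]; split=> // [i|a] lti.
  case: (eqVneq i (M 3)) => [->|ni]; last first.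
    by rewrite g2 ?(f9 i) //; lia.
  by rewrite g3 ?fc // => [|i']; lia.
by move=> na; rewrite g3 ?(f9 a) ?na //; [lia|move=> i li; apply: na; lia].
Qed.

(** Cell 1 starts at 16, so that the sum loop leaves the address [F] itself there. *)
Definition park_ell := [:: IConst 2 2; IAdd 2 2 0; IStore 2 1; IConst 1 16; IConst 2 1].
Definition store_sum := [:: IConst 2 16; ISub 2 1 2; IStore 1 2; IConst 0 0].
Definition store_scalars := [:: IConst 2 2; IAdd 2 2 0; ILoad 2 2; IStore 1 0; IConst 0 16; IAdd 0 0 1;
  IStore 0 2].
(** Copying starts at cell 16, whose target is [F + 16 * 16 + 1]; hence 257. *)
Definition init_copy := [:: IConst 3 16; IConst 4 257; IAdd 4 4 1; IConst 5 16; ISub 5 1 5; IConst 6 1;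
  IConst 7 16].

(* Only cells 0 and 1 hold no list entry. Cells 2 and [n + 2] may be overwritten nevertheless: they contain
   the first entries of two lists, and in a permutation one entry is determined by the others. With cell 2 as
   scratch and [ell] parked in cell [n + 2], [n] is turned into the address [F], which lies beyond the
   input, and back; then everything can be moved to the array area. *)
Definition prelude pc :=
  park_ell ++ sum_loop (pc + 5) ++ store_sum ++ unsum_loop (pc + 16) ++
  (store_scalars ++ save_cells (iota 3 13) ++ init_copy) ++ copy_loop (pc + 79).

(** Above the sixteen low cells, beyond the end of the input, larger than the number [2 * (n * n)]
    of nodes, and computable by additions. *)
Definition frame_size n := 16 + 2 * (n * n.+1).

Definition loaded n (E M : memory) : Prop :=
  let F := frame_size n in
  [/\ M 1 = F, M F = n, M (F + 16) = E 1,
      forall a, 2 < a < F -> a != n + 2 -> M (F + 16 * a + 1) = E a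
    & forall k i, 1 < k < 16 -> M (F + 16 * i + k) = 0].

Lemma prelude_code pc : code_at prog pc (prelude pc) ->
  [/\ code_at prog pc park_ell, code_at prog (pc + 5) (sum_loop (pc + 5)),
      code_at prog (pc + 12) store_sum /\ code_at prog (pc + 16) (unsum_loop (pc + 16)),
      code_at prog (pc + 26) (store_scalars ++ save_cells (iota 3 13) ++ init_copy)
    & code_at prog (pc + 79) (copy_loop (pc + 79))].
Proof.
case/code_at_cat => c1 /code_at_cat[c2 /code_at_cat[c3 /code_at_cat[c4 /code_at_cat[c5 c6]]]].
rewrite -!addnA in c2 c3 c4 c5 c6.
by split=> //; split.
Qed.

Lemma exec_store_scalars M n F ell a : 0 < n -> 2 < F -> M 0 = n -> M 1 = F -> M (n + 2) = ell ->
  exec store_scalars M a = if a == 16 + F then ell else if a == 0 then 16 + F else if a == F then n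
                    else if a == 2 then ell else M a.
Proof.
move=> n0 leF f0 e41 ell4; rewrite /exec /= /upd /= f0 e41.
have -> : (2 + n == 2) = false by lia.
have -> : 2 + n = n + 2 by lia.
rewrite ell4; have [-> ->] : (1 == F) = false /\ (2 == F) = false by lia.
by do 5!case: (_ =P _) => //.
Qed.

Lemma exec_init_copy M F : M 1 = F -> let M' := exec init_copy M in
  [/\ M' 1 = F, [/\ M' 3 = 16, M' 4 = 257 + F, M' 5 = F - 16, M' 6 = 1 & M' 7 = 16]
    & forall a, 8 < a -> M' a = M a].
Proof.
move=> e; rewrite /exec /= /upd /= e; split=> // a la.
by do 5?case: (_ =P _) => //; lia.
Qed.

Definition moved n F ell (E M : memory) :=
  [/\ M 1 = F, M F = n, M (F + 16) = ell & [/\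
    M 3 = 16, M 4 = 257 + F, M 5 = F - 16, M 6 = 1 & M 7 = 16] /\ [/\
    forall i, 2 < i < 16 -> i != n + 2 -> M (F + 16 * i + 1) = E i,
    forall a, 15 < a < F -> a != n + 2 -> M a = E a
    & forall a, F < a -> a != F + 16 -> (forall i, 2 < i < 16 -> a != F + 16 * i + 1) -> M a = 0]].

Lemma exec_move n F ell M4 (E : memory) : 0 < n -> 16 <= F -> n + 2 < F ->
  M4 0 = n -> M4 1 = F -> M4 (n + 2) = ell ->
  (forall a, 2 < a < F -> a != n + 2 -> M4 a = E a) -> (forall a, F < a -> M4 a = 0) ->
  moved n F ell E (exec init_copy (exec (save_cells (iota 3 13)) (exec store_scalars M4))).
Proof.
move=> n0 leF ltF f0 e41 ell4 eM4 eM4'; rewrite /moved.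
set N1 := exec store_scalars M4.
have eN1 a : N1 a = if a == 16 + F then ell else if a == 0 then 16 + F else if a == F then n
                    else if a == 2 then ell else M4 a.
  by apply: exec_store_scalars => //; lia.
clearbody N1; have l : all (fun i => 2 < i < 16) (iota 3 13) by [].
have n11 : N1 1 = F by rewrite eN1 /=; do 2?case: eqP => //; lia.
have [s1 s2 s3] := exec_save leF n11 l.
set N2 := exec (save_cells _) _ in s1 s2 s3 *; clearbody N2.
have mi i : (i \in iota 3 13) = (2 < i < 16) by rewrite mem_iota.
have n21 : N2 1 = F by rewrite s1 //; lia.
have [eN31 eN3 big] := exec_init_copy n21; clear n21.
split=> //; last split=> //.
- rewrite big ?s3; try lia; try by move=> i; rewrite mi; lia.
  by rewrite eN1 eqxx; do 2?case: eqP => //; lia.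
- rewrite big ?s3; try lia; try by move=> i; rewrite mi; lia.
  by rewrite eN1 addnC eqxx.
split=> [i li ni|a la na|a la na nb]; rewrite big; try lia.
- rewrite s2 ?mi // eN1 -(eM4 i) //; try lia.
  by do 4?case: eqP => //; lia.
- rewrite s1 -?(eM4 a) // ?eN1; try lia.
  by do 4?case: eqP => //; lia.
- rewrite s3; try lia; try by move=> i; rewrite mi; apply: nb.
  by rewrite eN1 eM4' //; do 4?case: eqP => //; lia.
Qed.

Lemma move_correct pc M (Q : memory -> Prop) :
  code_at prog pc (store_scalars ++ save_cells (iota 3 13) ++ init_copy) ->
  Q (exec init_copy (exec (save_cells (iota 3 13)) (exec store_scalars M))) ->
  goes prog 53 pc M (pc + 53) Q.
Proof.
by move=> hc q; apply: (goes_straight hc) => //; rewrite !exec_cat.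
Qed.

Lemma prelude_correct pc n (E : memory) : 0 < n -> E 0 = n ->
  (forall a, 2 * (n * n) + n + 2 <= a -> E a = 0) -> code_at prog pc (prelude pc) ->
  goes prog (20 * frame_size n + 100) pc E (pc + 86) (loaded n E).
Proof.
move=> n0 e0 ez; set F := frame_size n.
have leF : 16 <= F by rewrite /F /frame_size; lia.
have F_eq : F = 16 + 2 * (n * n.+1) by [].
rewrite /loaded -/F; clearbody F.
case/prelude_code => c1 c2 [c3 c4] c5 c6.
have hb1 : goes prog 5 pc E (pc + 5) (fun M => [/\ M 0 = n, M 1 = 16, M 2 = 1, M (n + 2) = E 1 &
    forall a, 2 < a -> a != n + 2 -> M a = E a]).
  apply: (@goes_straight park_ell) => //; rewrite /exec /= /upd /= e0.
  have [-> ->] : (n + 2 == 2) = false /\ (n + 2 == 1) = false by lia.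
  rewrite (addnC 2) eqxx; split=> // a la na; rewrite (negbTE na).
  by have [-> ->] : (a == 2) = false /\ (a == 1) = false by lia.
apply: goes_trans hb1 _ => [|M1 [a0 a1 a2 an ao]]; last first.
have hs := sum_loop_correct c2 a2 (etrans a0 (esym (prednK n0))).
apply: goes_trans hs _ => [|M2 [b0 b1 b2]]; last first.
rewrite a1 prednK // -F_eq in b1.
have hb2 : goes prog 4 (pc + 12) M2 (pc + 16) (fun M => [/\ M 0 = 0, M 1 = F,
   M F = 2 * (n * n.+1) & forall a, 2 < a -> a != F -> M a = M2 a]).
  have -> : pc + 16 = pc + 12 + 4 by lia.
  apply: (@goes_straight store_sum) => //; rewrite /exec /= /upd /= b1.
  have -> : (1 == F) = false by lia.
  rewrite eqxx; have -> : (F == 0) = false by lia.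
  split=> //; first lia.
  by move=> a la na; rewrite (negbTE na); have [-> ->] : (a == 0) = false /\ (a == 2) = false by lia.
have -> : pc + 5 + 7 = pc + 12 by lia.
apply: goes_trans hb2 _ => [|M3 [d0 d1 d2 d3]]; last first.
have := @unsum_loop_correct (pc + 16) 0 n.-1 F M3 c4 leF d1 d0.
rewrite prednK // add0n => hu.
apply: goes_trans (hu _) _ => [||M4 [f0 f1]]; last first.
have eM4 a : 2 < a < F -> a != n + 2 -> M4 a = E a.
  by move=> la na; rewrite f1 ?d3 ?b2 ?ao //; lia.
have ell4 : M4 (n + 2) = E 1.
  have ? : n + 2 < F by lia.
  by rewrite f1 ?d3 ?b2 ?an //; lia.
have eM4' a : F < a -> M4 a = 0.
  by move=> la; rewrite f1 ?d3 ?b2 ?ao ?ez //; lia.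
have e41 : M4 1 = F by rewrite f1 //; lia.
move: M4 f0 {f1} eM4 ell4 eM4' e41 => M4 f0 eM4 ell4 eM4' e41.
have -> : pc + 16 + 10 = pc + 26 by lia.
have ltF : n + 2 < F by lia.
have e79 : pc + 26 + 53 = pc + 79 by rewrite -addnA.
have hB := move_correct c5 (exec_move n0 leF ltF f0 e41 ell4 eM4 eM4').
rewrite e79 in hB; apply: goes_trans hB _ => [|M5 [g1 gF g16 [[g3 g4 g5 g6 g7] [h1 h2 h3]]]]; last first.
have -> : pc + 86 = pc + 79 + 7 by lia.
have := @copy_loop_correct (pc + 79) F (F - 16) M5 c6 leF g1.
rewrite g3 g4 => /(_ ltac:(lia) isT ltac:(lia) g5 g6 g7).
apply: goes_weaken (leqnn _) _ => M6 [k1 k2 k3]; split=> //.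
- by rewrite k3 //; lia.
- by rewrite k3 // => [|i li]; lia.
- move=> a la na; case: (ltnP a 16) => la'; last by rewrite k2 ?h2 //; lia.
  by rewrite k3 ?h1 //; [lia|lia|move=> i li; lia].
- by move=> k i lk; rewrite k3 ?h3 //; [lia..| |lia|]; move=> j lj; lia.
- exact: leqnn.
- by rewrite d2; lia.
- exact: leqnn.
- exact: leqnn.
- exact: leqnn.
- by lia.
Qed.

End Prelude.

(** * Maximum flow by breadth-first search *)

(** A syntactic overapproximation: storing at a computed index counts as writing to the whole
    array. *)
Fixpoint writes c k i : bool :=
  match c with
  | CSkip => false
  | CPut k' e _ => (k == k') && (if e is EC j then i == j else true)
  | CSeq a b | CIf _ a b => writes a k i || writes b k i
  | CLoop a => writes a k i
  end.

Lemma sem_frame F c s k i : ~~ writes c k i -> sem F c s k i = s k i.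
Proof.
elim: c s => [|k' e e'|a IHa b IHb|e a IHa b IHb|a IHa] s //=.
- by rewrite /put; case: (k == k') => //=; case: e => //= j /negbTE->.
- by rewrite negb_or => /andP[/IHa ea /IHb eb]; rewrite eb ea.
- by rewrite negb_or => /andP[/IHa ea /IHb eb]; case: ifP.
- by move=> /IHa e; elim: {1}F s => //= m IH s; rewrite e.
Qed.

Lemma iter_rule (I : nat -> state -> Prop) f F s :
  I 0 s -> (forall t s, t < F -> I t s -> I t.+1 (f s)) -> I F (iter F f s).
Proof.
move=> i0 st; have : F <= F by []; elim: {1 3 4}F => [|t IH] lt //=.
by apply: (st) => //; apply/IH/ltnW.
Qed.

Local Notation "'V' j" := (EA 0 (EC j)) (at level 8, j at level 2, only parsing).
Local Notation "a ;; b" := (CSeq a b) (at level 90, right associativity, only parsing).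
Local Notation "j ::= e" := (CPut 0 (EC j) e) (at level 80, only parsing).

Local Notation v_n := 0 (only parsing).
Local Notation v_ell := 1 (only parsing).
Local Notation v_N := 2 (only parsing).
Local Notation v_v := 3 (only parsing).
Local Notation v_k := 4 (only parsing).
Local Notation v_i := 5 (only parsing).
Local Notation v_off := 6 (only parsing).
Local Notation v_x := 7 (only parsing).
Local Notation v_y := 8 (only parsing).
Local Notation v_cnt := 9 (only parsing).
Local Notation v_goal := 10 (only parsing).
Local Notation v_q := 11 (only parsing).
Local Notation v_cur := 12 (only parsing).
Local Notation v_u := 13 (only parsing).
Local Notation v_val := 14 (only parsing).
Local Notation v_act := 15 (only parsing).
Local Notation v_ans := 16 (only parsing).

Local Notation a_in := 1 (only parsing).
Local Notation a_rank := 2 (only parsing).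
Local Notation a_off := 3 (only parsing).
Local Notation a_part := 4 (only parsing).
Local Notation a_C := 5 (only parsing).
Local Notation a_O := 6 (only parsing).
Local Notation a_I := 7 (only parsing).
Local Notation a_S := 8 (only parsing).
Local Notation a_T := 9 (only parsing).
Local Notation a_g1 := 10 (only parsing).
Local Notation a_g2 := 11 (only parsing).
Local Notation a_vis := 12 (only parsing).
Local Notation a_Q := 13 (only parsing).
Local Notation a_par := 14 (only parsing).
Local Notation a_kind := 15 (only parsing).

Definition push kd par : cmd :=
  CPut a_vis (V v_u) (EC 1) ;;
  CPut a_Q (V v_cnt) (V v_u) ;;
  CPut a_par (V v_cnt) par ;;
  CPut a_kind (V v_cnt) (EC kd) ;;
  CIf (EA a_T (V v_u)) (v_goal ::= EAdd (V v_cnt) (EC 1)) CSkip ;;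
  v_cnt ::= EAdd (V v_cnt) (EC 1).

Definition visit kd cond u : cmd :=
  CIf cond (v_u ::= u ;; CIf (EA a_vis (V v_u)) CSkip (push kd (V v_q))) CSkip.

Definition clear : cmd :=
  v_v ::= EC 0 ;; CLoop (CPut a_vis (V v_v) (EC 0) ;; v_v ::= EAdd (V v_v) (EC 1)).

Definition sources_body : cmd :=
  CIf (EA a_S (V v_v)) (v_u ::= V v_v ;; push 0 (EC 0)) CSkip ;;
  v_v ::= EAdd (V v_v) (EC 1).

Definition sources : cmd :=
  v_cnt ::= EC 0 ;; v_goal ::= EC 0 ;; v_v ::= EC 0 ;; CLoop sources_body.

Definition scan_body : cmd :=
  v_cur ::= EA a_Q (V v_q) ;;
  visit 1 (EA a_C (EAdd (V v_cur) (EC 1))) (EAdd (V v_cur) (EC 1)) ;;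
  visit 2 (EA a_O (V v_cur)) (ESub (EA a_O (V v_cur)) (EC 1)) ;;
  visit 3 (EA a_g1 (V v_cur)) (ESub (V v_cur) (EC 1)) ;;
  visit 4 (EA a_g2 (V v_cur)) (EA a_I (V v_cur)) ;;
  v_q ::= EAdd (V v_q) (EC 1).

Definition scan : cmd := v_q ::= EC 0 ;; CLoop (CIf (ESub (V v_cnt) (V v_q)) scan_body CSkip).

(** Kind 0 marks a root, where the supply is spent and the walk ends. The nested differences test
    for kinds 1, 2 and 3 and leave 4. *)
Definition back_body : cmd :=
  v_x ::= EA a_kind (V v_q) ;;
  CIf (V v_x)
    (v_cur ::= EA a_Q (EA a_par (V v_q)) ;; v_u ::= EA a_Q (V v_q) ;;
     CIf (ESub (V v_x) (EC 1))
       (CIf (ESub (V v_x) (EC 2))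
         (CIf (ESub (V v_x) (EC 3))
           (CPut a_g2 (V v_cur) (ESub (EA a_g2 (V v_cur)) (EC 1)))
           (CPut a_g1 (V v_cur) (ESub (EA a_g1 (V v_cur)) (EC 1))))
         (CPut a_g2 (V v_u) (EAdd (EA a_g2 (V v_u)) (EC 1))))
       (CPut a_g1 (V v_u) (EAdd (EA a_g1 (V v_u)) (EC 1))) ;;
     v_q ::= EA a_par (V v_q))
    (CPut a_S (EA a_Q (V v_q)) (EC 0) ;; v_act ::= EC 0).

Definition augment : cmd :=
  v_q ::= ESub (V v_goal) (EC 1) ;;
  CPut a_T (EA a_Q (V v_q)) (EC 0) ;;
  v_val ::= EAdd (V v_val) (EC 1) ;;
  v_act ::= EC 1 ;;
  CLoop (CIf (V v_act) back_body CSkip).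

Definition phase : cmd := clear ;; sources ;; scan ;; CIf (V v_goal) augment CSkip.

Section Phase.
Variables (N F : nat) (C O I S0 T0 : nat -> nat).
Hypothesis C_node : forall u, C u != 0 -> 0 < u < N.
Hypothesis O_node : forall v u, O v = u.+1 -> [/\ v < N, u < N & I u = v].
Hypothesis leNF : N <= F.
Implicit Types (s : state).

Section Search.
(* The network and the flow are read off from the state [s0] at the start of the phase: the search does not
   modify the arrays 5 to 11. *)
Variable s0 : state.
Hypothesis (eC : s0 a_C =1 C) (eO : s0 a_O =1 O) (eI : s0 a_I =1 I).
Hypothesis s0_flow : flow N C O I S0 T0 (s0 a_S) (s0 a_T) (s0 a_g1) (s0 a_g2).
Hypothesis s0_S : forall v, s0 a_S v != 0 -> v < N.

Let res := residual C O I (s0 a_g1) (s0 a_g2).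

Lemma res_node kd v u : v < N -> res kd v u -> u < N.
Proof.
rewrite /res; case: kd => [|[|[|[|[|kd]]]]] //= lv.
- by case/andP=> _ /C_node/andP[].
- by move/eqP/O_node => [].
- by case/andP=> /eqP ev _; lia.
- by case/andP=> /eqP -> /(flow_g2 s0_flow)/O_node[].
Qed.

(** Queue entries are distinct nodes, which bounds the queue by [N]; parents stand at smaller
    positions, so walks towards a root terminate. *)
Record tree s : Prop := Tree {
  tree_fix : forall k i, 4 < k < 12 -> s k i = s0 k i;
  tree_node : forall j, j < s 0 v_cnt -> s a_Q j < N;
  tree_inj : forall i j, i < s 0 v_cnt -> j < s 0 v_cnt -> s a_Q i = s a_Q j -> i = j;
  tree_vis : forall v, s a_vis v != 0 -> exists2 j, j < s 0 v_cnt & s a_Q j = v;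
  tree_seen : forall j, j < s 0 v_cnt -> s a_vis (s a_Q j) != 0;
  tree_par : forall j, j < s 0 v_cnt -> s a_kind j = 0 /\ s0 a_S (s a_Q j) != 0 \/
     s a_par j < j /\ res (s a_kind j) (s a_Q (s a_par j)) (s a_Q j);
  tree_goal : if s 0 v_goal is g.+1 then g < s 0 v_cnt /\ s0 a_T (s a_Q g) != 0
              else forall j, j < s 0 v_cnt -> s0 a_T (s a_Q j) = 0 }.

Lemma tree_cnt s : tree s -> s 0 v_cnt <= N.
Proof.
move=> t; have u : uniq (mkseq (s a_Q) (s 0 v_cnt)).
  apply/(uniqP 0) => i j; rewrite !inE size_mkseq => li lj.
  by rewrite !nth_mkseq //; apply: tree_inj.
have := uniq_leq_size u (s2 := iota 0 N); rewrite size_mkseq size_iota; apply.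
by move=> x /mapP[j]; rewrite !mem_iota /= add0n => lj ->; apply: tree_node.
Qed.

Definition grows s s' := [/\ s 0 v_cnt <= s' 0 v_cnt,
  forall j, j < s 0 v_cnt -> s' a_Q j = s a_Q j & forall v, s a_vis v != 0 -> s' a_vis v != 0].

Lemma grows_trans s1 s2 s3 : grows s1 s2 -> grows s2 s3 -> grows s1 s3.
Proof.
move=> [c1 q1 v1] [c2 q2 v2]; split=> [|j lj|v /v1/v2//]; first exact: leq_trans c2.
by rewrite q2 ?q1 //; apply: leq_trans c1.
Qed.

(** [par] is evaluated after [a_vis] and [a_Q] have been written, so it may depend on the scalars
    only. *)
Lemma push_correct kd par s : tree s -> s 0 v_u < N -> s a_vis (s 0 v_u) = 0 ->
  (forall s1, s1 0 =1 s 0 -> eval s1 par = eval s par) ->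
  kd = 0 /\ s0 a_S (s 0 v_u) != 0 \/
    eval s par < s 0 v_cnt /\ res kd (s a_Q (eval s par)) (s 0 v_u) ->
  let s' := sem F (push kd par) s in
  [/\ tree s', grows s s' & s' a_vis (s 0 v_u) != 0].
Proof.
move=> t ltu nv ep hk s'; set u := s 0 v_u in ltu nv hk *; set c := s 0 v_cnt in hk *.
have ec : s' 0 v_cnt = c.+1.
  by rewrite /s' /= /put /=; case: ifP; rewrite /= addn1.
have eQ j : s' a_Q j = if j == c then u else s a_Q j.
  by rewrite /s' /= /put /=; case: ifP.
have evis v : s' a_vis v = if v == u then 1 else s a_vis v.
  by rewrite /s' /= /put /=; case: ifP.
have ekind j : s' a_kind j = if j == c then kd else s a_kind j.
  by rewrite /s' /= /put /=; case: ifP.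
have epar j : s' a_par j = if j == c then eval s par else s a_par j.
  by rewrite /s' /= (ep (put (put s _ _ _) _ _ _)) // /put /=; case: ifP.
have egoal : s' 0 v_goal = if s a_T u == 0 then s 0 v_goal else c.+1.
  by rewrite /s' /= {1}/put /=; rewrite /put /=; case: ifP; rewrite ?addn1.
have efix k i : 4 < k < 12 -> s' k i = s0 k i.
  by move=> lk; rewrite /s' sem_frame ?(tree_fix t) //=; lia.
clearbody s'.
have new j : j < c -> s a_Q j != u.
  by move=> lj; apply/eqP => e; have := tree_seen t lj; rewrite e nv.
have eTu : s a_T u = s0 a_T u by rewrite (tree_fix t).
split; last 1 first.
- by rewrite evis eqxx.
- split=> //.
  + move=> j; rewrite ec eQ ltnS leq_eqVlt; case: eqP => //= _; exact: tree_node.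
  + move=> i j; rewrite !ec !eQ !ltnS (leq_eqVlt i) (leq_eqVlt j).
    case: eqP => [->|_] /=; case: eqP => [->|_] //= li lj.
    * by move=> e; have := new _ lj; rewrite -e eqxx.
    * by move=> e; have := new _ li; rewrite e eqxx.
    * exact: tree_inj.
  + move=> v; rewrite evis; case: (v =P u) => [-> _|_ /(tree_vis t)[j lj ej]].
      by exists c; rewrite ?ec // eQ eqxx.
    exists j; rewrite ?ec; first exact: ltnW.
    by rewrite eQ; case: eqP lj => // ->; rewrite ltnn.
  + move=> j; rewrite ec eQ evis ltnS leq_eqVlt; case: eqP => [_ _|_ /= lj].
      by rewrite eqxx.
    by case: ifP => // _; apply: tree_seen.
  + move=> j; rewrite ec ltnS leq_eqVlt ekind epar !eQ; case: eqP => [-> _|_ /= lj].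
      case: hk => [|[lp hr]]; first by left.
      by right; split=> //; case: eqP lp => [->|//]; rewrite ltnn.
    case: (tree_par t lj) => [|[lp hr]]; [by left|right].
    by split=> //; case: eqP lp => // ->; rewrite -/c; lia.
  + rewrite egoal eTu; case: eqP => Tu.
      move: (tree_goal t); case: (s 0 v_goal) => [h j|g [lg hg]].
        by rewrite ec eQ ltnS leq_eqVlt; case: eqP => // _; apply: h.
      rewrite ec eQ; split; first exact: ltnW.
      by case: (g =P c) lg => // ->; rewrite -/c ltnn.
    by rewrite ec eQ eqxx; split=> //; apply/eqP.
- split=> [|j lj|v]; first by rewrite ec -/c.
    by rewrite eQ; case: eqP lj => // ->; rewrite ltnn.
  by rewrite evis; case: (v =P u).
Qed.


Lemma tree_ext s s' : tree s -> (forall k i, 4 < k < 16 -> s' k i = s k i) ->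
  s' 0 v_cnt = s 0 v_cnt -> s' 0 v_goal = s 0 v_goal -> tree s'.
Proof.
move=> t ek ec eg; split; rewrite ?ec ?eg.
- by move=> k i lk; rewrite ek ?(tree_fix t) //; lia.
- by move=> j lj; rewrite ek //; apply: tree_node.
- by move=> i j li lj; rewrite !ek //; apply: tree_inj.
- by move=> v; rewrite ek // => /(tree_vis t)[j lj <-]; exists j; rewrite ?ek.
- by move=> j lj; rewrite !ek //; apply: tree_seen.
- by move=> j lj; rewrite !ek //; apply: tree_par.
- by move: (tree_goal t); case: (s 0 v_goal) => [h j lj|g [lg h]]; rewrite ek //; apply: h.
Qed.

Lemma grows_ext s s' : (forall k i, 4 < k < 16 -> s' k i = s k i) ->
  s' 0 v_cnt = s 0 v_cnt -> grows s s'.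
Proof. by move=> ek ec; split=> [|j _|v]; rewrite ?ec ?ek. Qed.

Lemma visit_correct kd cond ue s : tree s -> s 0 v_q < s 0 v_cnt -> kd != 0 ->
  (eval s cond != 0 -> res kd (s a_Q (s 0 v_q)) (eval s ue)) ->
  let s' := sem F (visit kd cond ue) s in
  [/\ tree s', grows s s' & eval s cond != 0 -> s' a_vis (eval s ue) != 0].
Proof.
move=> t lq kd0 hr s'.
have [c0|c1] := eqVneq (eval s cond) 0.
  have -> : s' = s by rewrite /s' /= c0.
  by split=> //; apply: grows_ext.
move/(_ c1) in hr; set u := eval s ue in hr *.
set s1 := put s 0 v_u u.
have t1 : tree s1 by apply: tree_ext t _ _ _ => // k i lk; rewrite /s1 /put; case: ifP => //; lia.
have g1 : grows s s1 by apply: grows_ext => // k i lk; rewrite /s1 /put; case: ifP => //; lia.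
have es : s' = if s a_vis u == 0 then sem F (push kd (V v_q)) s1 else s1.
  by rewrite /s' /= (negbTE c1) /=.
have lu : u < N by apply: res_node hr; apply: tree_node.
case: eqP es => [nv|/eqP vis] ->; last by [].
have [] := @push_correct kd (V v_q) s1 t1 lu nv.
- by move=> s2 e2; rewrite /= e2.
- by right; split=> //; apply: hr.
move=> t2 g2 v2; split=> //; exact: grows_trans g1 g2.
Qed.

Definition scanned s j := forall kd u, res kd (s a_Q j) u -> s a_vis u != 0.

Lemma scanned_grows s s' j : j < s 0 v_cnt -> grows s s' -> scanned s j -> scanned s' j.
Proof. by move=> lj [_ eQ ev] h kd u; rewrite eQ // => /h /ev. Qed.

Lemma scan_body_correct s : tree s -> s 0 v_q < s 0 v_cnt ->
  let s' := sem F scan_body s in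
  [/\ tree s', grows s s', s' 0 v_q = (s 0 v_q).+1 & scanned s' (s 0 v_q)].
Proof.
move=> t lq; set s' := sem F _ s; rewrite /=.
set q := s 0 v_q in lq *; set v := s a_Q q.
pose s1 := sem F (v_cur ::= EA a_Q (V v_q)) s.
pose s2 := sem F (visit 1 (EA a_C (EAdd (V v_cur) (EC 1))) (EAdd (V v_cur) (EC 1))) s1.
pose s3 := sem F (visit 2 (EA a_O (V v_cur)) (ESub (EA a_O (V v_cur)) (EC 1))) s2.
pose s4 := sem F (visit 3 (EA a_g1 (V v_cur)) (ESub (V v_cur) (EC 1))) s3.
pose s5 := sem F (visit 4 (EA a_g2 (V v_cur)) (EA a_I (V v_cur))) s4.
have es : s' = sem F (v_q ::= EAdd (V v_q) (EC 1)) s5 by [].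
have c1 : s1 0 v_cur = v by [].
have c2 : s2 0 v_cur = v by rewrite /s2 sem_frame.
have c3 : s3 0 v_cur = v by rewrite /s3 sem_frame.
have c4 : s4 0 v_cur = v by rewrite /s4 sem_frame.
have q1 : s1 0 v_q = q by rewrite /s1 sem_frame.
have q2 : s2 0 v_q = q by rewrite /s2 sem_frame.
have q3 : s3 0 v_q = q by rewrite /s3 sem_frame.
have q4 : s4 0 v_q = q by rewrite /s4 sem_frame.
have q5 : s5 0 v_q = q by rewrite /s5 sem_frame.
have e1 k i : 4 < k < 16 -> s1 k i = s k i by move=> lk; rewrite /s1 sem_frame //=; lia.
have t1 : tree s1 by apply: tree_ext t e1 _ _.
have g1 : grows s s1 by apply: grows_ext e1 _.
have Q1 : s1 a_Q q = v by rewrite e1.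
have l1 : q < s1 0 v_cnt by [].
have step sa kd cond ue : tree sa -> grows s sa -> sa 0 v_q = q -> kd != 0 ->
    (eval sa cond != 0 -> res kd v (eval sa ue)) ->
    let sb := sem F (visit kd cond ue) sa in
    [/\ tree sb, grows s sb, grows sa sb & eval sa cond != 0 -> sb a_vis (eval sa ue) != 0].
  move=> ta ga qa k0 hr; have [ca Qa va] := ga.
  have [||] := visit_correct ta _ k0 (cond := cond) (ue := ue).
  - by rewrite qa; apply: leq_trans ca.
  - by rewrite qa Qa.
  by move=> tb gb vb; split=> //; apply: grows_trans gb.
have [|t2 G2 g2 v2] := step s1 1 (EA a_C (EAdd (V v_cur) (EC 1))) (EAdd (V v_cur) (EC 1)) t1 g1 q1 isT.
  by rewrite /= c1 (tree_fix t1) // eC addn1 /res /= eqxx.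
rewrite -/s2 in t2 G2 g2 v2.
have [|t3 G3 g3 v3] := step s2 2 (EA a_O (V v_cur)) (ESub (EA a_O (V v_cur)) (EC 1)) t2 G2 q2 isT.
  by rewrite /= c2 (tree_fix t2) // eO /res /= => nz; lia.
rewrite -/s3 in t3 G3 g3 v3.
have [|t4 G4 g4 v4] := step s3 3 (EA a_g1 (V v_cur)) (ESub (V v_cur) (EC 1)) t3 G3 q3 isT.
  rewrite /= c3 (tree_fix t3) // /res /= => nz; rewrite nz andbT.
  by have := C_node (flow_g1 s0_flow nz); lia.
rewrite -/s4 in t4 G4 g4 v4.
have [|t5 G5 g5 v5] := step s4 4 (EA a_g2 (V v_cur)) (EA a_I (V v_cur)) t4 G4 q4 isT.
  by rewrite /= c4 !(tree_fix t4) // eI /res /= => ->; rewrite eqxx.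
rewrite -/s5 in t5 G5 g5 v5.
have e5 k i : 4 < k < 16 -> s' k i = s5 k i by move=> lk; rewrite es sem_frame //=; lia.
have t' : tree s' by apply: tree_ext t5 e5 _ _.
have g' : grows s5 s' by apply: grows_ext e5 _.
have g45 := grows_trans g5 g'; have g35 := grows_trans g4 g45; have g25 := grows_trans g3 g35.
have G' := grows_trans G5 g'.
split=> //; first by rewrite es /= /put /= q5 addn1.
have [_ Q' _] := G'.
have [_ _ m2] := g25; have [_ _ m3] := g35; have [_ _ m4] := g45; have [_ _ m5] := g'.
move=> kd u; rewrite Q' // -/v; case: kd => [|[|[|[|[|kd]]]]] //=.
- case/andP=> /eqP eu Cu; apply: m2; move: v2; rewrite /= c1 addn1 -eu; apply.
  by rewrite (tree_fix t1) // eC.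
- move/eqP=> eu; apply: m3; move: v3; rewrite /= c2 (tree_fix t2) // eO eu subn1 /=; exact.
- case/andP=> /eqP eu nz; apply: m4; move: v4; rewrite /= c3 (tree_fix t3) // eu subn1 /=.
  by apply; rewrite -eu.
- case/andP=> /eqP -> nz; apply: m5; move: v5; rewrite /= c4 !(tree_fix t4) // eI; exact.
Qed.

Lemma scan_correct s : tree s -> let s' := sem F scan s in
  [/\ tree s', grows s s' & forall j, j < s' 0 v_cnt -> scanned s' j].
Proof.
set f := sem F (CIf (ESub (V v_cnt) (V v_q)) scan_body CSkip); set s1 := put s 0 v_q 0.
move=> t; have -> : sem F scan s = iter F f s1 by [].
have e1 k i : 4 < k < 16 -> s1 k i = s k i by move=> lk; rewrite /s1 /put; case: ifP => //; lia.
(* Either each round so far has scanned an entry or the queue is exhausted. As the queue has at most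
   [N <= F] entries, all are scanned after [F] rounds. *)
have [] : let s' := iter F f s1 in [/\ tree s', grows s s', s' 0 v_q <= s' 0 v_cnt,
    F <= s' 0 v_q \/ s' 0 v_q = s' 0 v_cnt & forall j, j < s' 0 v_q -> scanned s' j].
  apply: (@iter_rule (fun m s' => [/\ tree s', grows s s', s' 0 v_q <= s' 0 v_cnt,
    m <= s' 0 v_q \/ s' 0 v_q = s' 0 v_cnt & forall j, j < s' 0 v_q -> scanned s' j])).
    split; [exact: tree_ext t e1 _ _|exact: grows_ext|by []|by left|by []].
  move=> m s2 _ [t2 g2 le2 m2 h2].
  have -> : f s2 = if s2 0 v_cnt - s2 0 v_q == 0 then s2 else sem F scan_body s2 by [].
  case: eqP => [e|/eqP ne].
    by split=> //; right; apply/eqP; rewrite eqn_leq le2 -subn_eq0 e.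
  have lt2 : s2 0 v_q < s2 0 v_cnt by rewrite -subn_gt0 lt0n.
  have [t3 g3 q3 h3] := scan_body_correct t2 lt2.
  have [c3 _ _] := g3.
  set s3 := sem F scan_body s2 in t3 g3 q3 h3 c3 *.
  split=> //.
  - exact: grows_trans g2 g3.
  - by rewrite q3; lia.
  - by rewrite q3; lia.
  - move=> j; rewrite q3 ltnS leq_eqVlt => /orP[/eqP->//|lj].
    by apply: scanned_grows g3 (h2 _ lj); apply: ltn_trans lt2.
move=> t' g' le' m' h'; split=> // j lj; apply: h'.
have := tree_cnt t'; lia.
Qed.

Lemma sources_correct s : (forall k i, 4 < k < 12 -> s k i = s0 k i) ->
  (forall v, s a_vis v = 0) ->
  let s' := sem F sources s in
  tree s' /\ forall v, s0 a_S v != 0 -> s' a_vis v != 0.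
Proof.
move=> ek v0; set f := sem F sources_body; set s1 := put (put (put s 0 v_cnt 0) 0 v_goal 0) 0 v_v 0.
have -> : sem F sources s = iter F f s1 by [].
(* All visited nodes lie below the running index, so the current one is new and may be pushed. *)
have : let s' := iter F f s1 in [/\ tree s', s' 0 v_v = F,
      forall v, s' a_vis v != 0 -> v < s' 0 v_v
    & forall v, v < s' 0 v_v -> s0 a_S v != 0 -> s' a_vis v != 0].
  apply: (@iter_rule (fun m s' => [/\ tree s', s' 0 v_v = m,
      forall v, s' a_vis v != 0 -> v < s' 0 v_v
    & forall v, v < s' 0 v_v -> s0 a_S v != 0 -> s' a_vis v != 0])).
    have e1 k i : 4 < k < 16 -> s1 k i = s k i.
      by move=> lk; rewrite /s1 /put; do 3?(case: ifP; first lia).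
    split=> //; last by move=> v; rewrite e1 // v0.
    split=> //.
    - by move=> k i lk; rewrite e1 ?ek //; lia.
    - by move=> v; rewrite e1 // v0.
  move=> m s2 ltm [t2 m2 d2 h2].
  have eS : s2 a_S m = s0 a_S m by rewrite (tree_fix t2).
  have ext (z : state) k i : 4 < k < 16 -> put z 0 v_v (z 0 v_v + 1) k i = z k i.
    by move=> lk; rewrite /put; case: ifP => //; lia.
  have fE : f s2 = let z := if s2 a_S (s2 0 v_v) == 0 then s2
                    else sem F (push 0 (EC 0)) (put s2 0 v_u (s2 0 v_v)) in
                  put z 0 v_v (z 0 v_v + 1) by [].
  have [S0m|Sm] := eqVneq (s0 a_S m) 0.
    have -> : f s2 = put s2 0 v_v (s2 0 v_v + 1) by rewrite fE m2 eS S0m /= m2.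
    split; first apply: tree_ext t2 (ext _) _ _ => //.
    + by rewrite /put /= m2 addn1.
    + by move=> v /d2; rewrite /put /= m2 addn1 => lv; apply: ltnW.
    + move=> v; rewrite /put /= m2 addn1 ltnS leq_eqVlt => /orP[/eqP->|lv]; first by rewrite S0m.
      by apply: h2; rewrite m2.
  set s3 := put s2 0 v_u m.
  have e3 k i : 4 < k < 16 -> s3 k i = s2 k i by move=> lk; rewrite /s3 /put; case: ifP => //; lia.
  have t3 : tree s3 by apply: tree_ext t2 e3 _ _.
  have g3 : grows s2 s3 by apply: grows_ext e3 _.
  set s4 := sem F (push 0 (EC 0)) s3.
  have -> : f s2 = put s4 0 v_v (s4 0 v_v + 1) by rewrite fE m2 eS (negbTE Sm).
  have m4 : s4 0 v_v = m by rewrite /s4 sem_frame //= /s3 /put /= m2.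
  have vis4 v : s4 a_vis v = if v == m then 1 else s2 a_vis v.
    by rewrite /s4 /= /s3 /put /=; case: ifP.
  have [] := @push_correct 0 (EC 0) s3 t3 (s0_S Sm).
  - by apply/eqP/contraT; rewrite e3 // => /d2; rewrite m2 ltnn.
  - by move=> s5 _.
  - by left.
  rewrite -/s4; move=> t4 g4 v4.
  split; first apply: tree_ext t4 (ext _) _ _ => //.
  + by rewrite /put /= m4 addn1.
  + move=> v; rewrite ext // vis4 /put /= m4 addn1; case: (v =P m) => [->//|_ /d2].
    by rewrite m2 => lv; apply: ltnW.
  + move=> v; rewrite (ext _ a_vis) // /put /= m4 addn1 vis4 ltnS leq_eqVlt; case: (v =P m) => //= _ lv.
    by apply: h2; rewrite m2.
case=> t' m' _ h'; split=> // v nz; apply: h' => //; rewrite m'.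
exact: leq_trans (s0_S nz) leNF.
Qed.

End Search.

Lemma clear_correct s : (forall v, F <= v -> s a_vis v = 0) ->
  let s' := sem F clear s in
  (forall v, s' a_vis v = 0) /\ forall k i, 4 < k < 12 -> s' k i = s k i.
Proof.
move=> hF s'; split; last by move=> k i lk; rewrite /s' sem_frame //=; lia.
have [m h] : s' 0 v_v = F /\ forall v, v < F \/ F <= v -> s' a_vis v = 0.
  apply: (@iter_rule (fun m s' => s' 0 v_v = m /\ forall v, v < m \/ F <= v -> s' a_vis v = 0)).
    by split=> // v [//|/hF].
  move=> m s2 ltm [m2 h2]; split=> [|v lv]; first by rewrite /= /put /= m2 addn1.
  rewrite /= /put /= m2; case: eqP => // nv; apply: h2; lia.
by move=> v; apply: h; case: (ltnP v F); [left|right].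
Qed.

Lemma sum_upd0 (S : nat -> nat) x : x < N -> S x = 1 ->
  (\sum_(v < N) upd S x 0 v).+1 = \sum_(v < N) S v.
Proof.
move=> lx e; rewrite (bigD1 (Ordinal lx)) //= [RHS](bigD1 (Ordinal lx)) //= e add1n.
rewrite /upd eqxx add0n; congr _.+1; apply: eq_bigr => v.
by rewrite -val_eqE /= => /negbTE ->.
Qed.

(** A push from [v] lowers only flow whose cancelling arc leaves [v]. Residual arcs out of other
    nodes survive, in particular those on the rest of the path. *)
Lemma residual_push g1 g2 kd v u kd' v' u' : v' != v ->
  residual C O I g1 g2 kd' v' u' ->
  residual C O I (push1 g1 kd v u) (push2 g2 kd v u) kd' v' u'.
Proof.
move=> /negbTE nv; case: kd' => [|[|[|[|[|kd']]]]] //= /andP[-> nz] /=.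
- case: kd => [|[|[|[|kd]]]] //=; rewrite /upd ?nv //; case: (v' =P u) => //.
- case: kd => [|[|[|[|[|kd]]]]] //=; rewrite /upd ?nv //; case: (v' =P u) => //.
Qed.

Definition network s := [/\ s a_C =1 C, s a_O =1 O & s a_I =1 I].

Definition flow_inv s : Prop := [/\ network s,
  flow N C O I S0 T0 (s a_S) (s a_T) (s a_g1) (s a_g2),
  forall v, s a_S v != 0 -> v < N, value N S0 (s a_S) (s 0 v_val)
  & forall v, F <= v -> s a_vis v = 0].

Lemma back_body_correct s x : 
  network s -> x = s a_Q (s 0 v_q) ->
  defect_flow N C O I S0 T0 x (s a_S) (s a_T) (s a_g1) (s a_g2) ->
  let s' := sem F back_body s in
  let q := s 0 v_q in let p := s a_par q in
  if s a_kind q == 0 then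
    s a_S x != 0 -> [/\ flow N C O I S0 T0 (s' a_S) (s' a_T) (s' a_g1) (s' a_g2),
                       s' a_S =1 upd (s a_S) x 0 & s' 0 v_act = 0]
  else residual C O I (s a_g1) (s a_g2) (s a_kind q) (s a_Q p) x ->
    [/\ defect_flow N C O I S0 T0 (s a_Q p) (s' a_S) (s' a_T) (s' a_g1) (s' a_g2),
         s' 0 v_q = p, s' a_S =1 s a_S, s' a_g1 =1 push1 (s a_g1) (s a_kind q) (s a_Q p) x
       & s' a_g2 =1 push2 (s a_g2) (s a_kind q) (s a_Q p) x].
Proof.
move=> [eC eO eI] ex df s' q p.
have fT v : s' a_T v = s a_T v by rewrite /s' sem_frame.
case: eqP => [k0|/eqP k0].
  have sE : s' = put (put (put s 0 v_x 0) a_S x 0) 0 v_act 0.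
    by rewrite /s' /back_body /= -/q /put /= k0 /= ex.
  move=> Sx; have eS : s' a_S =1 upd (s a_S) x 0 by rewrite sE.
  split=> //; last by rewrite sE.
  apply: defect_flow_ext (flow_end df Sx) => // v; by rewrite ?eS ?fT // sE.
move=> hr.
have eS : s' a_S =1 s a_S.
  move=> v; rewrite /s' /back_body /= /put /= -/q (negbTE k0).
  by do ?case: ifP.
have e1 : s' a_g1 =1 push1 (s a_g1) (s a_kind q) (s a_Q p) x.
  move=> v; rewrite /s' /back_body /= /put /= -/q (negbTE k0).
  by move: k0 hr; case: (s a_kind q) => [|[|[|[|[|kd]]]]] //= _ _; rewrite /upd -?ex ?addn1 ?subn1 /=.
have e2 : s' a_g2 =1 push2 (s a_g2) (s a_kind q) (s a_Q p) x.
  move=> v; rewrite /s' /back_body /= /put /= -/q (negbTE k0).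
  by move: k0 hr; case: (s a_kind q) => [|[|[|[|[|kd]]]]] //= _ _; rewrite /upd -?ex ?addn1 ?subn1 /=.
split=> //.
  by apply: defect_flow_ext (flow_push O_node df hr) => // v; rewrite ?eS ?fT ?e1 ?e2.
by rewrite /s' /back_body /= /put /= -/q (negbTE k0) /=; do 3?case: ifP.
Qed.

Lemma augment_correct s0 s g : flow_inv s0 -> tree s0 s -> s 0 v_val = s0 0 v_val ->
  s 0 v_goal = g.+1 ->
  let s' := sem F augment s in flow_inv s' /\ s' 0 v_val = (s0 0 v_val).+1.
Proof.
move=> [nw fl hS hv hvis] t evs eg s'; have [eC eO eI] := nw.
have := tree_goal t; rewrite eg => -[lg Tg].
set Q := s a_Q; set K := s a_kind; set P := s a_par; set c := s 0 v_cnt in lg *.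
pose s1 := put (put (put (put s 0 v_q g) a_T (Q g) 0) 0 v_val (s0 0 v_val).+1) 0 v_act 1.
set f := fun z : state => if eval z (V v_act) == 0 then z else sem F back_body z.
have es' : s' = iter F f s1.
  rewrite (_ : s' = iter F f (put (put (put (put s 0 v_q (s 0 v_goal - 1))
    a_T (s a_Q (s 0 v_goal - 1)) 0) 0 v_val (s 0 v_val + 1)) 0 v_act 1)) //.
  by rewrite eg subn1 evs addn1.
have e1 k i : 4 < k < 16 -> k != a_T -> s1 k i = s k i.
  by move=> lk kT; rewrite /s1 /put /=; do !(case: ifP; first lia).
have fix1 k : 4 < k < 12 -> k != a_T -> s1 k =1 s0 k.
  by move=> lk kT i; rewrite e1 ?(tree_fix t) //; lia.
have nw1 : network s1 by split=> v; rewrite fix1.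
have T1 : s1 a_T =1 upd (s0 a_T) (Q g) 0.
  by move=> v; rewrite /s1 /put /upd /=; case: ifP => // _; rewrite (tree_fix t).
pose valid z j := K j = 0 /\ z a_S (Q j) != 0 \/
  P j < j /\ residual C O I (z a_g1) (z a_g2) (K j) (Q (P j)) (Q j).
have res_ext (g1 g2 g1' g2' : nat -> nat) kd v u : g1 =1 g1' -> g2 =1 g2' ->
    residual C O I g1 g2 kd v u -> residual C O I g1' g2' kd v u.
  by move=> h1 h2; case: kd => [|[|[|[|[|kd]]]]] //=; rewrite ?h1 ?h2.
(* [v_val] is raised at once but [a_S] changes only at the root, so an active walk satisfies the
   value equation with the old value. Each active round moves to a smaller queue position. *)
pose inv m (z : state) := [/\ network z, [/\ z a_Q =1 Q, z a_kind =1 K & z a_par =1 P],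
  z 0 v_val = (s0 0 v_val).+1, (forall v, z a_S v != 0 -> v < N) /\
    (forall v, F <= v -> z a_vis v = 0)
  & if z 0 v_act == 0 then
      flow N C O I S0 T0 (z a_S) (z a_T) (z a_g1) (z a_g2) /\ value N S0 (z a_S) (z 0 v_val)
    else [/\ z 0 v_q + m <= g,
      defect_flow N C O I S0 T0 (Q (z 0 v_q)) (z a_S) (z a_T) (z a_g1) (z a_g2),
      value N S0 (z a_S) (s0 0 v_val) & forall j, j <= z 0 v_q -> valid z j]].
have i1 : inv 0 s1.
  split=> //.
  - split=> v; first by rewrite fix1 //; apply: hS.
    rewrite e1 // => lv; apply/eqP/contraT => /(tree_vis t)[j lj ej].
    by have := tree_node t lj; rewrite ej; lia.
  rewrite [s1 0 v_act]/=.
  have -> : s1 0 v_q = g by [].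
  split; first by rewrite addn0.
  - apply: defect_flow_ext (flow_start fl Tg) => v; rewrite ?T1 ?fix1 //.
  - rewrite /value -hv; congr (_ + _); apply: eq_bigr => v _; exact: fix1.
  - move=> j lj; have [|[k0 Sj]|[lp hr]] := tree_par t (j := j); first exact: leq_ltn_trans lg.
      by left; split=> //; rewrite fix1.
    by right; split=> //; apply: res_ext hr => v; rewrite fix1.
have : inv F (iter F f s1).
  apply: iter_rule i1 _ => m z ltm [nwz [eQ eK eP] ev [hSz hvz] hz].
  rewrite /f [eval _ _]/=; case: eqP hz => [act0 hz|/eqP act [lq df hvl hval]].
    by split=> //; rewrite act0.
  have hb := @back_body_correct z (Q (z 0 v_q)) nwz (esym (eQ _)) df; cbv zeta in hb.
  set z' := sem F back_body z in hb *; set q := z 0 v_q in lq hval df hb *.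
  have fr k i : 11 < k -> z' k i = z k i by move=> lk; rewrite /z' sem_frame //=; lia.
  have frI k i : 4 < k < 8 -> z' k i = z k i by move=> lk; rewrite /z' sem_frame //=; lia.
  have nw' : network z' by case: nwz => [h1 h2 h3]; split=> v; rewrite frI.
  have ev' : z' 0 v_val = (s0 0 v_val).+1 by rewrite /z' sem_frame.
  have eQ' : [/\ z' a_Q =1 Q, z' a_kind =1 K & z' a_par =1 P] by split=> v; rewrite fr.
  have hv' v : F <= v -> z' a_vis v = 0 by rewrite fr //; apply: hvz.
  have lgc : q < c by apply: leq_ltn_trans lg; lia.
  move: hb; rewrite eK; case: eqP => [k0 h|k0 h].
    have Sq : z a_S (Q q) != 0.
      case: (hval q (leqnn _)) => [[]//|[_]]; by rewrite k0.
    have [fz eS a0] := h Sq.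
    split=> //; first split=> // v.
      by rewrite eS /upd; case: (v =P Q q) => // _; apply: hSz.
    rewrite a0 eqxx; split=> //; rewrite /value ev' -hvl addSnnS; congr (_ + _).
    rewrite (eq_bigr (fun v : 'I_N => upd (z a_S) (Q q) 0 v)) => [|v _]; last exact: eS.
    apply: sum_upd0; first exact: tree_node t _ lgc.
    by have := flow_S df (Q q); move: Sq; lia.
  have [lp hr] : P q < q /\ residual C O I (z a_g1) (z a_g2) (K q) (Q (P q)) (Q q).
    by case: (hval q (leqnn _)) => [[]|].
  rewrite eP eQ in h; have [df' q' eS h1 h2] := h hr.
  have act' : z' 0 v_act = z 0 v_act.
    by rewrite /z' /back_body /= /put /= -/q eK; case: eqP k0 => //= _ _; do ?case: ifP.
  split=> //; first by split=> // v; rewrite eS; apply: hSz.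
  rewrite act' (negbTE act) q'; split=> //.
  - by lia.
  - by rewrite /value -hvl; congr (_ + _); apply: eq_bigr => v _; rewrite eS.
  move=> j lj; have [|[kj Sj]|[lpj hj]] := hval j; first by lia.
    by left; rewrite eS.
  have np : Q (P j) != Q (P q).
    by apply/eqP => e; have : P j = P q; [apply: (tree_inj t) e; rewrite -/c; lia|lia].
  right; split=> //; apply: res_ext (residual_push (K q) (Q q) np hj).
  - by move=> v; rewrite h1.
  - by move=> v; rewrite h2.
rewrite -es'; case=> nw' _ ev [hS' hv'].
(* A walk still active after [F] rounds would give [F <= g], but [g] is a position in a queue of at
   most [N <= F] entries. *)
case: eqP => [_ [fl' val']|_ [lq _ _ _]]; first by split.
have := leq_trans lg (tree_cnt t); lia.
Qed.

Definition stuck s := exists2 X, arc_closed C O X & cut N S0 T0 X <= s 0 v_val.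

Lemma phase_correct s : flow_inv s -> let s' := sem F phase s in
  flow_inv s' /\ (s' 0 v_val = (s 0 v_val).+1 \/ s' 0 v_val = s 0 v_val /\ stuck s').
Proof.
move=> inv s'; have [nw fl hS hv hvis] := inv; have [eC eO eI] := nw.
pose s1 := sem F clear s; pose s2 := sem F sources s1; pose s3 := sem F scan s2.
have es' : s' = if s3 0 v_goal == 0 then s3 else sem F augment s3 by [].
have [v1 f1] := clear_correct hvis; rewrite -/s1 in v1 f1.
have [t2 S2] := sources_correct hS f1 v1; rewrite -/s2 in t2 S2.
have [t3 [_ _ g3] sc] := scan_correct eC eO eI fl t2; rewrite -/s3 in t3 g3 sc.
have ev : s3 0 v_val = s 0 v_val by rewrite /s3 sem_frame // /s2 sem_frame // /s1 sem_frame.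
case E: (s3 0 v_goal) => [|g]; last first.
  have {}es' : s' = sem F augment s3 by rewrite es' E.
  by have [i' v'] := augment_correct inv t3 ev E; rewrite -es' in i' v'; split=> //; left.
have {}es' : s' = s3 by rewrite es' E.
have fx := tree_fix t3; rewrite -es' in t3 ev fx sc g3 E.
split.
  split=> //.
  - by split=> v; rewrite fx.
  - by apply: defect_flow_ext fl => v; rewrite fx.
  - by move=> v; rewrite fx //; apply: hS.
  - by rewrite /value ev -hv; congr (_ + _); apply: eq_bigr => v _; rewrite fx.
  - move=> v lv; apply/eqP/contraT => /(tree_vis t3)[j lj ej].
    by have := tree_node t3 lj; rewrite ej; lia.
(* The visited set is the certificate: complete scanning closes it under all residual arcs, and
   kinds 1 and 2 are the arcs of the network. *)
right; split=> //; rewrite /stuck; exists (fun v => s' a_vis v != 0).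
  split=> [u Cu|v u Ov] /(tree_vis t3)[j lj ej].
    by apply: (sc _ lj 1); rewrite ej /= eqxx.
  by apply: (sc _ lj 2); rewrite ej /= Ov.
rewrite ev; apply: (stuck_flow_eq_cut C_node O_node fl hv).
- move=> u gu /(tree_vis t3)[j lj ej]; apply: (sc _ lj 3).
  by rewrite ej /= eqxx gu.
- move=> u gu /(tree_vis t3)[j lj ej]; apply: (sc _ lj 4).
  by rewrite ej /= eqxx gu.
- by move=> v /S2 /g3.
- move=> v /(tree_vis t3)[j lj <-].
  by have := tree_goal t3; rewrite E => /(_ _ lj).
Qed.

Definition max_flow : cmd := v_val ::= EC 0 ;; CLoop phase.

Lemma max_flow_correct s : N < F -> (forall v, S0 v <= 1) -> (forall v, T0 v <= 1) ->
  (forall v, S0 v != 0 -> v < N) -> network s -> s a_S =1 S0 -> s a_T =1 T0 ->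
  (forall v, s a_g1 v = 0) -> (forall v, s a_g2 v = 0) -> (forall v, s a_vis v = 0) ->
  let s' := sem F max_flow s in
  (forall X, arc_closed C O X -> s' 0 v_val <= cut N S0 T0 X) /\ stuck s'.
Proof.
move=> ltNF S1 T1 SN nw eS eT e1 e2 ev s'; set s1 := put s 0 v_val 0.
have i1 : flow_inv s1.
  split=> //.
  - split=> //= [v ltv|v|v|u|u].
    + rewrite /s1 /put /= eS eT !e1 e2 /cross_out.
      case: (O v) => [|u]; rewrite ?e2; case: eqP ltv => [->|_ _]; rewrite ?ltnn //; lia.
    + by rewrite /s1 /put /= eS.
    + by rewrite /s1 /put /= eT.
    + by rewrite /s1 /put /= e1.
    + by rewrite /s1 /put /= e2.
  - by move=> v; rewrite /s1 /put /= eS; apply: SN.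
  - by rewrite /value add0n; apply: eq_bigr => v _; rewrite /s1 /put /= eS.
  - by move=> v _; apply: ev.
(* Each phase raises the value or yields a certificate, which later phases cannot invalidate. The
   value never reaches [F], since the total supply is at most [N < F]. *)
have [inv' h] : flow_inv s' /\ (F <= s' 0 v_val \/ stuck s').
  have -> : s' = iter F (sem F phase) s1 by [].
  apply: (@iter_rule (fun m z => flow_inv z /\ (m <= z 0 v_val \/ stuck z))).
    by split; [exact: i1|left].
  move=> m z _ [iz hz]; have [iz' hz'] := phase_correct iz; split=> //.
  case: hz' => [e|[_]]; last by right.
  case: hz => [le|[X cX lX]]; first by left; rewrite e.
  by right; exists X => //; rewrite e; apply: leqW.
have [_ fl _ hv _] := inv'; split=> [X|]; first exact: flow_le_cut fl hv.
case: h => // leF; have : s' 0 v_val <= \sum_(v < N) S0 v by rewrite -hv leq_addr.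
have : \sum_(v < N) S0 v <= \sum_(v < N) 1 by apply: leq_sum => v _.
rewrite sum1_card card_ord; lia.
Qed.

End Phase.

(** * Building the network *)

Definition for_loop i b body : cmd :=
  i ::= EC 0 ;; CLoop (CIf (ESub b (V i)) (body ;; i ::= EAdd (V i) (EC 1)) CSkip).

Lemma for_rule (J : nat -> state -> Prop) F i b body m s : m <= F ->
  ~~ writes body 0 i ->
  (forall k z, J k z -> eval z b = m) ->
  (forall k z w, J k z -> J k (put z 0 i w)) ->
  J 0 s ->
  (forall k z, k < m -> z 0 i = k -> J k z -> J k.+1 (sem F body z)) ->
  J m (sem F (for_loop i b body) s).
Proof.
move=> leF wi hb hs j0 st.
set f := sem F (CIf (ESub b (V i)) (body ;; i ::= EAdd (V i) (EC 1)) CSkip).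
have -> : sem F (for_loop i b body) s = iter F f (put s 0 i 0) by [].
have fE z : f z = if eval z b - z 0 i == 0 then z
    else put (sem F body z) 0 i (sem F body z 0 i + 1) by [].
have [] : (let z := iter F f (put s 0 i 0) in z 0 i = minn F m /\ J (minn F m) z).
  apply: (@iter_rule (fun t z => z 0 i = minn t m /\ J (minn t m) z)).
    by rewrite min0n /put !eqxx; split=> //; apply: hs.
  move=> t z ltt [zi Jz]; rewrite fE (hb _ _ Jz) zi; case: eqP => [e|/eqP ne].
    by have -> : minn t.+1 m = minn t m by [lia].
  have -> : minn t.+1 m = (minn t m).+1 by lia.
  split; first by rewrite /put !eqxx sem_frame // zi addn1.
  by apply/hs/st => //; lia.
by have -> : minn F m = m by lia.
Qed.

(** Quotient, remainder and row start of the running index are maintained by counting, since the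
    machine cannot divide. *)
Definition tick : cmd :=
  v_i ::= EAdd (V v_i) (EC 1) ;;
  CIf (ESub (V v_n) (V v_i)) CSkip
    (v_i ::= EC 0 ;; v_k ::= EAdd (V v_k) (EC 1) ;; v_off ::= EAdd (V v_off) (V v_n)).

(* A single loop over all pairs (k, i) with i < n, coded as v = k * n + i. *)
Definition pair_loop body : cmd :=
  v_k ::= EC 0 ;; v_i ::= EC 0 ;; v_off ::= EC 0 ;;
  for_loop v_v (V v_N) (body ;; tick).

Section Pairs.
Variables (F n N : nat).
Hypothesis (n_gt0 : 0 < n) (leNF : N <= F).

Definition at_pair v (z : state) := [/\ z 0 v_v = v, z 0 v_k = v %/ n, z 0 v_i = v %% n,
  z 0 v_off = v %/ n * n & z 0 v_n = n /\ z 0 v_N = N].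

Lemma pair_rule (J : nat -> state -> Prop) body s :
  all (fun j => ~~ writes body 0 j) [:: v_n; v_N; v_v; v_k; v_i; v_off] ->
  s 0 v_n = n -> s 0 v_N = N ->
  (forall v z z', (forall k i, 0 < k -> z' k i = z k i) -> J v z -> J v z') ->
  J 0 s ->
  (forall v z, v < N -> at_pair v z -> J v z -> J v.+1 (sem F body z)) ->
  let s' := sem F (pair_loop body) s in [/\ J N s', s' 0 v_n = n & s' 0 v_N = N].
Proof.
move=> /= /and5P[w1 w2 w3 w4 /and3P[w5 w6 _]] en eN hs j0 st.
pose inv v (z : state) := [/\ z 0 v_k = v %/ n, z 0 v_i = v %% n, z 0 v_off = v %/ n * n,
  z 0 v_n = n /\ z 0 v_N = N & J v z].
suff [_ _ _ []] : inv N (sem F (pair_loop body) s) by [].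
pose s1 := put (put (put s 0 v_k 0) 0 v_i 0) 0 v_off 0.
have -> : sem F (pair_loop body) s = sem F (for_loop v_v (V v_N) (body ;; tick)) s1 by [].
apply: for_rule => //.
- by rewrite /= (negbTE w3).
- by move=> k z [_ _ _ [_ e] _].
- move=> k z w [h1 h2 h3 [h4 h5] h6]; split=> //; apply: hs h6 => k' i lk.
  by rewrite /put; case: ifP => //; lia.
- split; rewrite ?div0n ?mod0n //; apply: hs j0 => k' i lk.
  by rewrite /s1 /put; do 3?(case: ifP; first lia).
move=> v z ltv ev [h1 h2 h3 [h4 h5] h6].
have J1 := st v z ltv _ h6; move/(_ _)/wrap: J1 => [|J1]; first by split.
set z1 := sem F body z in J1.
have -> : sem F (body ;; tick) z = sem F tick z1 by [].
have k1 : z1 0 v_k = v %/ n by rewrite /z1 sem_frame.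
have i1 : z1 0 v_i = v %% n by rewrite /z1 sem_frame.
have o1 : z1 0 v_off = v %/ n * n by rewrite /z1 sem_frame.
have n1 : z1 0 v_n = n by rewrite /z1 sem_frame.
have N1 : z1 0 v_N = N by rewrite /z1 sem_frame.
have ha : forall k i, 0 < k -> sem F tick z1 k i = z1 k i.
  by move=> k i lk; rewrite sem_frame //=; lia.
have ltm := ltn_pmod v n_gt0.
have ed := divn_eq v n.
have es : sem F tick z1 0 v_i = v.+1 %% n /\ sem F tick z1 0 v_k = v.+1 %/ n /\
    sem F tick z1 0 v_off = v.+1 %/ n * n.
  have -> : v.+1 = v %/ n * n + (v %% n).+1 by lia.
  rewrite /tick /= /put /= n1 i1 k1 o1 divnMDl // modnMDl addn1.
  case: eqP => [e|/eqP ne] /=.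
    have -> : (v %% n).+1 = n by lia.
    by rewrite modnn divnn n_gt0; split=> //; split; lia.
  have lt1 : (v %% n).+1 < n by lia.
  by rewrite k1 o1 (modn_small lt1) (divn_small lt1) !addn0.
case: es => es1 [es2 es3]; split=> //.
- by rewrite sem_frame // sem_frame.
- exact: hs ha J1.
Qed.

End Pairs.

Definition node_count : cmd :=
  v_N ::= EC 0 ;; for_loop v_i (V v_n) (v_N ::= EAdd (V v_N) (EAdd (V v_n) (V v_n))).

Definition offsets : cmd :=
  v_off ::= EC 0 ;;
  for_loop v_k (EAdd (V v_n) (V v_n))
    (CPut a_off (V v_k) (V v_off) ;; v_off ::= EAdd (V v_off) (V v_n)).

(* Rank 0 is never written: it is the initial content of the array, and the first entries of two of the
   lists have been overwritten. *)
Definition ranks : cmd :=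
  pair_loop (CIf (V v_i)
    (CPut a_rank (EAdd (V v_off) (EA a_in (EAdd (V v_v) (EC 2)))) (V v_i)) CSkip).

(** The inverse of [mu] is not part of the input; visiting man [k] fills the row of his partner as
    well. *)
Definition partners : cmd :=
  for_loop v_k (V v_n)
    (v_x ::= EA a_in (EAdd (V v_k) (EAdd (V v_N) (EC 2))) ;;
     CPut a_part (V v_k) (EA a_rank (EAdd (EA a_off (V v_k)) (V v_x))) ;;
     CPut a_part (EAdd (V v_n) (V v_x))
       (EA a_rank (EAdd (EA a_off (EAdd (V v_n) (V v_x))) (V v_k)))).

Definition nodes : cmd :=
  pair_loop (CIf (ESub (EA a_part (V v_k)) (V v_i))
    (CIf (V v_i) (CPut a_C (V v_v) (EC 1)) CSkip ;;
     CIf (ESub (V v_n) (V v_k)) (CPut a_S (V v_v) (EC 1)) (CPut a_T (V v_v) (EC 1)))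
    CSkip).

(** Only rows of men are processed, so each pair is met once. Heads are stored plus one, leaving 0
    for the absence of an arc. *)
Definition arcs : cmd :=
  pair_loop (CIf (ESub (V v_n) (V v_k))
    (v_y ::= EA a_rank (EAdd (EA a_off (EAdd (V v_n) (V v_i))) (V v_k)) ;;
     CIf (ESub (EA a_part (V v_k)) (EA a_rank (V v_v)))
       (CIf (ESub (EA a_part (EAdd (V v_n) (V v_i))) (V v_y))
         (v_x ::= EAdd (V v_off) (ESub (ESub (EA a_part (V v_k)) (EA a_rank (V v_v))) (EC 1)) ;;
          v_y ::= EAdd (EA a_off (EAdd (V v_n) (V v_i))) (V v_y) ;;
          CPut a_O (V v_x) (EAdd (V v_y) (EC 1)) ;;
          CPut a_I (V v_y) (V v_x))
         CSkip)
       CSkip)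
    CSkip).

Definition build : cmd := node_count ;; offsets ;; ranks ;; partners ;; nodes ;; arcs.

Lemma pair_inj n k k' i i' : i < n -> i' < n -> k * n + i = k' * n + i' -> k = k' /\ i = i'.
Proof.
move=> li li' e; have n0 : 0 < n by lia.
have := congr1 (divn^~ n) e; have := congr1 (modn^~ n) e.
by rewrite !modnMDl !divnMDl // !modn_small // !divn_small // !addn0.
Qed.

Section Build.
Variables (n ell : nat) (lst : nat -> seq nat) (mu nu : nat -> nat).
Let N := 2 * (n * n).
Hypothesis n_gt0 : 0 < n.
Hypothesis lst_perm : forall k, k < 2 * n -> perm_eq (lst k) (iota 0 n).
Hypothesis (mu_lt : forall m, m < n -> mu m < n) (nu_lt : forall w, w < n -> nu w < n).
Hypothesis (muK : forall m, m < n -> nu (mu m) = m) (nuK : forall w, w < n -> mu (nu w) = w).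

(* Row [k < n] is man [k] and row [n + w] is woman [w]; [part k] is the rank of the partner in list [k]. *)
Definition rank k x := index x (lst k).
Definition part k := rank k (if k < n then mu k else nu (k - n)).

Record input_state (s : state) : Prop := InputState {
  in_n : s 0 v_n = n;
  in_ell : s 0 v_ell = ell;
  in_lst : forall k i, k < 2 * n -> 0 < i < n -> s a_in (k * n + i + 2) = nth 0 (lst k) i;
  in_mu : forall m, m < n -> s a_in (m + (N + 2)) = mu m;
  in_zero : forall k i, 1 < k < 16 -> s k i = 0 }.

Lemma lst_uniq k : k < 2 * n -> uniq (lst k).
Proof. by move/lst_perm/perm_uniq->; rewrite iota_uniq. Qed.

Lemma lst_size k : k < 2 * n -> size (lst k) = n.
Proof. by move/lst_perm/perm_size->; rewrite size_iota. Qed.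

Lemma lst_mem k x : k < 2 * n -> (x \in lst k) = (x < n).
Proof. by move/lst_perm/perm_mem->; rewrite mem_iota. Qed.

Lemma rank_lt k x : k < 2 * n -> x < n -> rank k x < n.
Proof. by move=> lk lx; rewrite -[ltnRHS](lst_size lk) index_mem lst_mem. Qed.

Lemma rank_inj k x y : k < 2 * n -> x < n -> y < n -> rank k x = rank k y -> x = y.
Proof.
move=> lk lx ly e; have mx : x \in lst k by rewrite lst_mem.
have my : y \in lst k by rewrite lst_mem.
by rewrite -(nth_index 0 mx) -(nth_index 0 my) -/(rank _ _) e.
Qed.

Lemma part_lt k : k < 2 * n -> part k < n.
Proof.
move=> lk; apply: rank_lt => //; case: (ltnP k n) => [/mu_lt//|le]; apply: nu_lt.
by rewrite ltn_subLR // addnn -mul2n.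
Qed.

(* The node [k * n + i] exists if [i < part k]. In the row of a man, [i.+1] is the distance to the partner, in
   the row of a woman [i] is the position in her list; thus every chain arc goes from some [v] to [v.+1]. *)
Definition net_C v : nat := (v < N) && (0 < v %% n < part (v %/ n)).
Definition net_S v : nat := (v < n * n) && (v %% n < part (v %/ n)).
Definition net_T v : nat := (n * n <= v < N) && (v %% n < part (v %/ n)).

Definition blocking m w := (rank m w < part m) && (rank (n + w) m < part (n + w)).
Definition man_node m w := m * n + (part m - (rank m w).+1).
Definition woman_node m w := (n + w) * n + rank (n + w) m.

(** Ranks within a list are distinct; [blocking] keeps the truncated subtraction from merging nodes.
    Hence one entry of [O] per node is enough. *)
Lemma man_node_inj m w m' w' : m < n -> w < n -> m' < n -> w' < n ->
  blocking m w -> blocking m' w' -> man_node m w = man_node m' w' -> m = m' /\ w = w'.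
Proof.
move=> lm lw lm' lw' /andP[b _] /andP[b' _] e.
have p1 : part m < n by apply: part_lt; lia.
have p2 : part m' < n by apply: part_lt; lia.
have q1 : part m - (rank m w).+1 < n by lia.
have q2 : part m' - (rank m' w').+1 < n by lia.
have [em er] := pair_inj q1 q2 e.
by subst m'; split=> //; apply: (@rank_inj m) => //; lia.
Qed.

Lemma woman_node_inj m w m' w' : m < n -> w < n -> m' < n -> w' < n ->
  woman_node m w = woman_node m' w' -> m = m' /\ w = w'.
Proof.
move=> lm lw lm' lw' e.
have p1 : rank (n + w) m < n by apply: rank_lt; lia.
have p2 : rank (n + w') m' < n by apply: rank_lt; lia.
have [em er] := pair_inj p1 p2 e; have ew : w = w' by lia.
by subst w'; split=> //; apply: (@rank_inj (n + w)) => //; lia.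
Qed.

(** * Closed sets of nodes and covering thresholds *)

Section Cut.
Variable O : nat -> nat.
Hypothesis O_blocking : forall m w, m < n -> w < n -> blocking m w ->
  O (man_node m w) = (woman_node m w).+1.
Hypothesis O_man : forall x, O x != 0 ->
  exists m w, [/\ m < n, w < n, blocking m w & x = man_node m w].

Lemma sum_rows m (G : nat -> nat) :
  \sum_(v < m * n) G v = \sum_(k < m) \sum_(i < n) G (k * n + i).
Proof.
elim: m => [|m IH]; first by rewrite !big_ord0.
rewrite big_ord_recr /= -IH -!(big_mkord xpredT) mulSn addnC.
rewrite (big_cat_nat (n := m * n)) ?leq_addr //=; congr (_ + _).
by rewrite -{1}[m * n]add0n big_addn addKn ?big_mkord; apply: eq_bigr => i _; rewrite addnC.
Qed.

Lemma sum_range m a b : \sum_(i < m) (a <= i < b) = minn m b - a.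
Proof.
elim: m => [|m IH]; first by rewrite big_ord0; lia.
by rewrite big_ord_recr /= IH; lia.
Qed.

Definition covers (K : nat -> nat) := forall m w, m < n -> w < n -> blocking m w ->
  part m - rank m w <= K m \/ part (n + w) - rank (n + w) m <= K (n + w).

Lemma divmod_node k i : i < n -> (k * n + i) %/ n = k /\ (k * n + i) %% n = i.
Proof. by move=> li; rewrite divnMDl // modnMDl divn_small // modn_small // addn0. Qed.

Lemma lt_node k i : k < 2 * n -> i < n -> k * n + i < N.
Proof.
move=> lk li; have : k.+1 * n <= 2 * n * n by rewrite leq_mul2r lk orbT.
by rewrite /N mulnA mulSn; lia.
Qed.

Lemma net_CE k i : k < 2 * n -> i < n -> net_C (k * n + i) = (0 < i < part k).
Proof. by move=> lk li; rewrite /net_C lt_node //; have [-> ->] := divmod_node k li. Qed.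

Lemma net_SE k i : k < 2 * n -> i < n -> net_S (k * n + i) = (k < n) && (i < part k).
Proof.
move=> lk li; have [e1 e2] := divmod_node k li.
by rewrite /net_S e1 e2 -ltn_divLR // e1.
Qed.

Lemma net_TE k i : k < 2 * n -> i < n -> net_T (k * n + i) = (n <= k) && (i < part k).
Proof.
move=> lk li; have [e1 e2] := divmod_node k li.
by rewrite /net_T e1 e2 lt_node // andbT -leq_divRL // e1.
Qed.

(** A closed set is upward closed in every row. The threshold of a man counts his nodes outside [X],
    that of a woman her nodes inside. The cross arc of a blocking pair forces its man's node out of
    [X] or its woman's node into [X], and the chain then supplies all nearer nodes. *)
Lemma cut_covers X : arc_closed net_C O X ->
  exists2 K, covers K & \sum_(k < 2 * n) K k = cut N net_S net_T X.
Proof.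
move=> [cC cO].
pose K k := \sum_(i < n) (if X (k * n + i) then net_T (k * n + i) else net_S (k * n + i)).
exists K; last first.
  by rewrite /cut /N mulnA (sum_rows (2 * n) (fun v => if X v then net_T v else net_S v)).
have up k i j : k < 2 * n -> i <= j -> j < part k -> X (k * n + i) -> X (k * n + j).
  move=> lk lij lj Xi; elim: j lij lj => [|j IH] lij lj.
    by move: lij; rewrite leqn0 => /eqP e; rewrite -e.
  move: lij; rewrite leq_eqVlt => /orP[/eqP<-//|lij].
  have lp := part_lt lk; rewrite addnS; apply: cC; last by apply: IH; lia.
  by rewrite -addnS net_CE ?lj //; lia.
move=> m w lm lw b; have [b1 b2] := andP b.
have lm2 : m < 2 * n by lia.
have lw2 : n + w < 2 * n by lia.
have pm := part_lt lm2; have pw := part_lt lw2.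
case Xm: (X (man_node m w)); [right|left].
  have Xw := cO _ _ (O_blocking lm lw b) Xm.
  have -> : part (n + w) - rank (n + w) m =
      \sum_(i < n) (rank (n + w) m <= i < part (n + w)) by rewrite sum_range; lia.
  apply: leq_sum => i _; case: (boolP (_ <= i < _)) => // /andP[li lj].
  by rewrite (up _ _ _ lw2 li lj Xw) net_TE // leq_addr lj.
have -> : part m - rank m w = \sum_(i < n) (0 <= i < part m - rank m w).
  by rewrite sum_range; lia.
apply: leq_sum => i _ /=; case: (ltnP i) => // li.
have nX : X (m * n + i) = false.
  apply: contraFF Xm; rewrite /man_node; apply: up => //; lia.
by rewrite nX net_SE // lm; have -> : i < part m by lia.
Qed.

Lemma covers_cut K : covers K ->
  exists2 X, arc_closed net_C O X & cut N net_S net_T X <= \sum_(k < 2 * n) K k.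
Proof.
(* A man's node enters the set when its distance [i.+1] exceeds [K k], a woman's when its distance
   [part k - i] is at most [K k]. Only an inequality results, since [K k] may exceed the number of
   nodes in the row. *)
move=> cK; pose Y k i := if k < n then K k <= i else part k <= i + K k.
exists (fun v => Y (v %/ n) (v %% n)).
  split=> [u|v u Ov].
    move=> Cu; have [lu /andP[lu0 lup]] : u.+1 < N /\ 0 < u.+1 %% n < part (u.+1 %/ n).
      by move: Cu; rewrite /net_C; case: (u.+1 < N) => //=; case: (0 < _ < _).
    have ed := divn_eq u.+1 n; have ltm := ltn_pmod u.+1 n_gt0.
    have eu : u = u.+1 %/ n * n + (u.+1 %% n).-1 by lia.
    have lt1 : (u.+1 %% n).-1 < n by lia.
    have [e1 e2] := divmod_node (u.+1 %/ n) lt1; rewrite -eu in e1 e2.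
    by rewrite e1 e2 /Y; case: ifP; lia.
  have [|m [w [lm lw b ev]]] := @O_man v; first by rewrite Ov.
  have [b1 b2] := andP b.
  have pm : part m < n by apply: part_lt; lia.
  have pw : part (n + w) < n by apply: part_lt; lia.
  have eu : u = woman_node m w by move: Ov; rewrite ev O_blocking // => -[].
  have l1 : part m - (rank m w).+1 < n by lia.
  have l2 : rank (n + w) m < n by lia.
  rewrite ev eu /man_node /woman_node.
  have [-> ->] := divmod_node m l1; have [-> ->] := divmod_node (n + w) l2.
  rewrite /Y lm ltnNge leq_addr /= => h; case: (cK m w lm lw b); lia.
rewrite /cut /N mulnA (sum_rows (2 * n) (fun v => if Y (v %/ n) (v %% n) then net_T v else net_S v)).
apply: leq_sum => k _; have lk := ltn_ord k; have pk := part_lt lk.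
case: (ltnP k n) => lkn.
  apply: (@leq_trans (\sum_(i < n) (0 <= i < K k))); last by rewrite sum_range; lia.
  apply: leq_sum => i _; have [-> ->] := divmod_node k (ltn_ord i).
  rewrite /Y lkn net_TE // net_SE // lkn (leqNgt n) lkn /=.
  by case: (leqP (K k) i) => //= _; case: (i < part k).
apply: (@leq_trans (\sum_(i < n) (part k - K k <= i < part k))); last by rewrite sum_range; lia.
apply: leq_sum => i _; have [-> ->] := divmod_node k (ltn_ord i).
have nk : (k < n) = false by lia.
rewrite /Y nk net_TE // net_SE // lkn nk /= leq_subLR addnC.
by case: (part k <= _).
Qed.

End Cut.

(** * Correctness of the stages of the network construction *)

Section Stages.
Variable F : nat.
Hypothesis leF : 2 + N + n <= F.

Lemma node_count_correct s : input_state s -> let s' := sem F node_count s in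
  input_state s' /\ s' 0 v_N = N.
Proof.
move=> h s'; split.
  case: h => h1 h2 h3 h4 h5; split=> *; rewrite /s' sem_frame //= ?h3 ?h4 ?h5 //; lia.
have [] : s' 0 v_n = n /\ s' 0 v_N = 2 * (n * n).
  apply: (@for_rule (fun k z => z 0 v_n = n /\ z 0 v_N = 2 * (k * n)) F v_i (V v_n)
    (v_N ::= EAdd (V v_N) (EAdd (V v_n) (V v_n))) n (put s 0 v_N 0)) => //.
  - by lia.
  - by move=> k z [].
  - by split=> //; rewrite /= /put /= (in_n h).
  - by move=> k z lk zi [h1 h2]; split=> //; rewrite /= /put /= h1 h2; lia.
by [].
Qed.

Lemma offsets_correct s : input_state s -> s 0 v_N = N -> let s' := sem F offsets s in
  [/\ s' 0 v_n = n, s' 0 v_N = N & forall k, k < 2 * n -> s' a_off k = k * n].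
Proof.
move=> h eN s'; rewrite /s' !sem_frame // (in_n h) eN; split=> // k lk.
have [] : [/\ s' 0 v_n = n, s' 0 v_off = 2 * n * n & forall k, k < 2 * n -> s' a_off k = k * n].
  apply: (@for_rule (fun m z => [/\ z 0 v_n = n, z 0 v_off = m * n
      & forall k, k < m -> z a_off k = k * n]) F v_k (EAdd (V v_n) (V v_n))
    (CPut a_off (V v_k) (V v_off) ;; v_off ::= EAdd (V v_off) (V v_n)) (2 * n) (put s 0 v_off 0)) => //.
  - by have := leq_pmulr n n_gt0; have := leF; rewrite /N; lia.
  - by move=> m z [h1 _ _]; rewrite /= h1; lia.
  - by split=> //; rewrite /= /put /= (in_n h).
  move=> m z lm zi [h1 h2 h3]; split=> //; first by rewrite /= /put /= h1 h2; lia.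
  move=> j lj; rewrite /= /put /= zi; case: eqP => [->//|ne]; apply: h3; lia.
by move=> _ _; apply.
Qed.

Lemma ranks_correct s : s 0 v_n = n -> s 0 v_N = N ->
  (forall k i, k < 2 * n -> 0 < i < n -> s a_in (k * n + i + 2) = nth 0 (lst k) i) ->
  (forall i, s a_rank i = 0) -> let s' := sem F ranks s in
  forall k x, k < 2 * n -> x < n -> s' a_rank (k * n + x) = rank k x.
Proof.
move=> en eN hin hz s'.
pose J v (z : state) := (forall i, z a_in i = s a_in i) /\
  forall k x, k < 2 * n -> x < n ->
    z a_rank (k * n + x) = if k * n + rank k x < v then rank k x else 0.
have [] := @pair_rule F n N n_gt0 _ J (CIf (V v_i)
    (CPut a_rank (EAdd (V v_off) (EA a_in (EAdd (V v_v) (EC 2)))) (V v_i)) CSkip) s isT en eN.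
- by lia.
- by move=> v z z' e [h1 h2]; split=> [i|k x lk lx]; rewrite e // ?h1 ?h2.
- by split=> // k x _ _; rewrite hz ltn0.
- move=> v z lv [zv zk zi zo [zn zN]] [h1 h2].
  have ltm := ltn_pmod v n_gt0; have ed := divn_eq v n.
  have lk : v %/ n < 2 * n by rewrite ltn_divLR //; move: lv; rewrite /N; lia.
  split=> [i|k x lk' lx]; first by rewrite sem_frame.
  have lrk := rank_lt lk' lx.
  rewrite /= zi; case: eqP => [e|/eqP ne].
    (* In column 0 nothing is written, and the initial 0 is already the rank of the first entry. *)
    rewrite h2 // ltnS [in RHS]leq_eqVlt; case: eqP => //= ev.
    rewrite {1}ed in ev; have [_ ->] := pair_inj lrk ltm ev.
    by rewrite e if_same.
  rewrite zo zv h1; set x0 := s a_in _; set k0 := v %/ n in ed lk *.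
  set i0 := v %% n in ed ltm ne *.
  have ex0 : x0 = nth 0 (lst k0) i0 by rewrite -hin ?ltm ?andbT ?lt0n // -ed.
  have m0 : x0 \in lst k0 by rewrite ex0 mem_nth ?lst_size.
  have lx0 : x0 < n by rewrite -(lst_mem x0 lk).
  have r0 : rank k0 x0 = i0 by rewrite /rank ex0 index_uniq ?lst_size ?lst_uniq.
  rewrite /put /=; case: eqP => [e|nex].
    by have [-> ->] := pair_inj lx lx0 e; rewrite r0 -ed ltnSn.
  rewrite h2 // ltnS [in RHS]leq_eqVlt; case: (k * n + rank k x =P v) => //= e.
  rewrite ed in e; have [ek er] := pair_inj lrk ltm e; case: nex.
  by rewrite ek; congr (_ + _); apply: (@rank_inj k0) => //; rewrite r0 -er ek.
move=> [_ h] _ _ k x lk lx; apply: etrans (h k x lk lx) _.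
have lr := rank_lt lk lx; have -> // : k * n + rank k x < N.
have : k.+1 * n <= 2 * n * n by rewrite leq_mul2r lk orbT.
by rewrite /N mulnA mulSn; lia.
Qed.

Lemma partners_correct s : s 0 v_n = n -> s 0 v_N = N ->
  (forall m, m < n -> s a_in (m + (N + 2)) = mu m) ->
  (forall k, k < 2 * n -> s a_off k = k * n) ->
  (forall k x, k < 2 * n -> x < n -> s a_rank (k * n + x) = rank k x) ->
  let s' := sem F partners s in forall k, k < 2 * n -> s' a_part k = part k.
Proof.
move=> en eN hin ho hr s'.
pose J m (z : state) := [/\ z 0 v_n = n /\ z 0 v_N = N,
  [/\ forall i, z a_in i = s a_in i, forall i, z a_off i = s a_off i
    & forall i, z a_rank i = s a_rank i]
  & forall m', m' < m -> z a_part m' = part m' /\ z a_part (n + mu m') = part (n + mu m')].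
have [] : J n s'.
  apply: (@for_rule J) => //.
  - by lia.
  - by move=> k z [[]].
  move=> m z lm zk [[zn zN] [h1 h2 h3] h4].
  have lmu := mu_lt lm; have l1 : m < 2 * n by lia.
  have l2 : n + mu m < 2 * n by lia.
  have p1 : part m = rank m (mu m) by rewrite /part lm.
  have p2 : part (n + mu m) = rank (n + mu m) m.
    by rewrite /part ltnNge leq_addr /= addKn muK.
  split; [by rewrite !sem_frame|by split=> i; rewrite sem_frame|].
  move=> m' lm'; rewrite /= /put /= zk zN h1 hin // zn !h2 !ho // !h3 !hr // -p1 -p2.
  split.
    have -> : (m' == n + mu m) = false by lia.
    by case: eqP => [->//|ne]; case: (h4 m') => //; lia.
  rewrite eqn_add2l; case: eqP => [->//|ne].
  have -> : (n + mu m' == m) = false by lia.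
  have nm : m' != m by apply/eqP => e; case: ne; rewrite e.
  by case: (h4 m') => //; lia.
move=> _ _ h k lk; case: (ltnP k n) => [/h[]//|le].
have lw : k - n < n by lia.
by have [_] := h _ (nu_lt lw); rewrite nuK // subnKC.
Qed.

Lemma nodes_correct s : s 0 v_n = n -> s 0 v_N = N ->
  (forall k, k < 2 * n -> s a_part k = part k) ->
  (forall k i, 4 < k < 10 -> s k i = 0) -> let s' := sem F nodes s in
  [/\ s' a_C =1 net_C, s' a_S =1 net_S, s' a_T =1 net_T, s' 0 v_n = n & s' 0 v_N = N].
Proof.
move=> en eN hp hz s'.
pose J v (z : state) := (forall i, z a_part i = s a_part i) /\
  forall x, [/\ z a_C x = (x < v) * net_C x, z a_S x = (x < v) * net_S x
               & z a_T x = (x < v) * net_T x].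
have [] := @pair_rule F n N n_gt0 _ J (CIf (ESub (EA a_part (V v_k)) (V v_i))
    (CIf (V v_i) (CPut a_C (V v_v) (EC 1)) CSkip ;;
     CIf (ESub (V v_n) (V v_k)) (CPut a_S (V v_v) (EC 1)) (CPut a_T (V v_v) (EC 1)))
    CSkip) s isT en eN.
- by lia.
- by move=> v z z' e [h1 h2]; split=> [i|x]; rewrite !e //; apply: h2.
- by split=> // x; rewrite !hz // ltn0.
- move=> v z lv [zv zk zi zo [zn zN]] [h1 h2].
  have ltm := ltn_pmod v n_gt0; have ed := divn_eq v n.
  have lk : v %/ n < 2 * n by rewrite ltn_divLR //; move: lv; rewrite /N; lia.
  have eS : (v < n * n) = (v %/ n < n) by rewrite ltn_divLR.
  split=> [i|x]; first by rewrite sem_frame.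
  have [xC xS xT] := h2 x.
  have lt1 : x < v.+1 = (x == v) || (x < v) by rewrite ltnS leq_eqVlt.
  have [->|nx] := eqVneq x v; last first.
    rewrite lt1 (negbTE nx) /= -xC -xS -xT.
    rewrite /= zk zi h1 hp //; case: ifP => // _.
    by case: (v %% n == 0); rewrite /put /= zn zk zv; case: ifP => _; rewrite /= ?(negbTE nx).
  have [vC vS vT] := h2 v; rewrite ltnn !mul0n in vC vS vT.
  rewrite ltnSn !mul1n /net_C /net_S /net_T lv andbT (leqNgt (n * n)) eS /= zk zi zv h1 hp //.
  rewrite subn_eq0 (leqNgt (part _)); case: (ltnP (v %% n) (part _)) => lp; last first.
    by rewrite /= !andbF vC vS vT.
  rewrite !andbT /= lt0n.
  case: (v %% n =P 0) => ei; rewrite /put /= zn zk zv subn_eq0 (leqNgt n); case: (ltnP (v %/ n) n) => lkn;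
    by rewrite /= ?eqxx ?vC ?vS ?vT.
move=> [_ h] hn hN; split=> // x; have [hC hS hT] := h x.
- by apply: etrans hC _; rewrite /net_C; case: (x < N); rewrite ?mul1n.
- apply: etrans hS _; rewrite /net_S; case: (ltnP x (n * n)) => lx /=; last by rewrite muln0.
  by have -> : x < N by [rewrite /N; lia]; rewrite mul1n.
- by apply: etrans hT _; rewrite /net_T; case: (x < N); rewrite ?mul1n // andbF.
Qed.

Lemma arcs_correct s : s 0 v_n = n -> s 0 v_N = N ->
  (forall k, k < 2 * n -> s a_off k = k * n) ->
  (forall k x, k < 2 * n -> x < n -> s a_rank (k * n + x) = rank k x) ->
  (forall k, k < 2 * n -> s a_part k = part k) ->
  (forall i, s a_O i = 0) -> let s' := sem F arcs s in
  (forall m w, m < n -> w < n -> blocking m w ->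
     s' a_O (man_node m w) = (woman_node m w).+1 /\ s' a_I (woman_node m w) = man_node m w) /\
  (forall x, s' a_O x != 0 ->
     exists m w, [/\ m < n, w < n, blocking m w & x = man_node m w]).
Proof.
move=> en eN ho hr hp hz s'.
pose J v (z : state) := [/\ [/\ forall i, z a_off i = s a_off i, forall i, z a_rank i = s a_rank i
    & forall i, z a_part i = s a_part i],
  forall m w, m < n -> w < n -> m * n + w < v -> blocking m w ->
     z a_O (man_node m w) = (woman_node m w).+1 /\ z a_I (woman_node m w) = man_node m w
  & forall x, z a_O x != 0 ->
     exists m w, [/\ m < n, w < n, blocking m w & x = man_node m w]].
set body := CIf (ESub (V v_n) (V v_k))
    (v_y ::= EA a_rank (EAdd (EA a_off (EAdd (V v_n) (V v_i))) (V v_k)) ;;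
     CIf (ESub (EA a_part (V v_k)) (EA a_rank (V v_v)))
       (CIf (ESub (EA a_part (EAdd (V v_n) (V v_i))) (V v_y))
         (v_x ::= EAdd (V v_off) (ESub (ESub (EA a_part (V v_k)) (EA a_rank (V v_v))) (EC 1)) ;;
          v_y ::= EAdd (EA a_off (EAdd (V v_n) (V v_i))) (V v_y) ;;
          CPut a_O (V v_x) (EAdd (V v_y) (EC 1)) ;;
          CPut a_I (V v_y) (V v_x))
         CSkip)
       CSkip)
    CSkip.
have [] := @pair_rule F n N n_gt0 _ J body s isT en eN.
- by lia.
- move=> v z z' e [[h1 h2 h3] h4 h5]; split.
  + by split=> i; rewrite e.
  + by move=> m w lm lw lv b; rewrite !e //; apply: h4.
  + by move=> x; rewrite e //; apply: h5.
- by split=> // x; rewrite hz.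
- move=> v z lv [zv zk zi zo [zn zN]] [[h1 h2 h3] h4 h5].
  have ltm := ltn_pmod v n_gt0; have ed := divn_eq v n.
  set m0 := v %/ n in zk zo ed *; set w0 := v %% n in zi ltm ed *.
  have fx : [/\ forall i, sem F body z a_off i = s a_off i,
     forall i, sem F body z a_rank i = s a_rank i & forall i, sem F body z a_part i = s a_part i].
    by split=> i; rewrite sem_frame.
  have vals : m0 < n -> [/\ s a_off (n + w0) = (n + w0) * n, s a_rank v = rank m0 w0,
      s a_rank ((n + w0) * n + m0) = rank (n + w0) m0, s a_part m0 = part m0
    & s a_part (n + w0) = part (n + w0)].
    by move=> l0; rewrite {1}ed !hp ?ho ?hr //; lia.
  have [bl|nbl] := boolP ((m0 < n) && blocking m0 w0); last first.
    have eO x : sem F body z a_O x = z a_O x /\ sem F body z a_I x = z a_I x.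
      rewrite /= zn zk subn_eq0 leqNgt; case: (ltnP m0 n) nbl vals => //= l0 nbl.
      case=> // e1 e2 e3 e4 e5; rewrite /put /= zn zi zk zv !h3 !h2 !h1 e1 e2 e3 e4 e5.
      rewrite !subn_eq0 !(leqNgt (part _)); move: nbl; rewrite /blocking.
      by case: (ltnP (rank m0 w0)) => //= _ /negbTE ->.
    split=> // [m w lm lw|x]; last by have [-> _] := eO x; apply: h5.
    rewrite ltnS leq_eqVlt => /orP[/eqP e|lt] b.
      rewrite ed in e; have [em ew] := pair_inj lw ltm e.
      by case/negP: nbl; rewrite -em -ew lm.
    by have [-> _] := eO (man_node m w); have [_ ->] := eO (woman_node m w); apply: h4.
  case/andP: bl => l0 bl.
  have eO x : sem F body z a_O x = (if x == man_node m0 w0 then (woman_node m0 w0).+1 else z a_O x)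
      /\ sem F body z a_I x = (if x == woman_node m0 w0 then man_node m0 w0 else z a_I x).
    have [e1 e2 e3 e4 e5] := vals l0; have [b1 b2] := andP bl.
    rewrite /= zn zk subn_eq0 leqNgt l0 /= /put /= zn zi zk zv zo !h3 !h2 !h1 e1 e2 e3 e4 e5.
    by rewrite !subn_eq0 !(leqNgt (part _)) b1 b2 /= -subnDA addn1 addn1 /man_node /woman_node.
  split=> // [m w lm lw lt b|x].
    have [eO1 _] := eO (man_node m w); have [_ eI1] := eO (woman_node m w).
    rewrite eO1 eI1; have [e|ne] := eqVneq (m * n + w) v.
      by rewrite ed in e; have [-> ->] := pair_inj lw ltm e; rewrite !eqxx.
    have ne' : ~ (m = m0 /\ w = w0) by case=> em ew; case/eqP: ne; rewrite em ew -ed.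
    case: eqP => [/(man_node_inj lm lw l0 ltm b bl)//|_].
    case: eqP => [/(woman_node_inj lm lw l0 ltm)//|_].
    by apply: h4 => //; rewrite ltn_neqAle ne -ltnS.
  have [-> _] := eO x; case: (x =P man_node m0 w0) => [-> _|_]; last exact: h5.
  by exists m0, w0.
move=> [_ h4 h5] _ _; split=> [m w lm lw|x]; last exact: h5.
apply: h4 => //; have : m.+1 * n <= n * n by rewrite leq_mul2r lm orbT.
by rewrite /N mulSn; lia.
Qed.


Lemma build_correct s : input_state s -> let s' := sem F build s in
  [/\ [/\ s' a_C =1 net_C, s' a_S =1 net_S & s' a_T =1 net_T],
      forall m w, m < n -> w < n -> blocking m w ->
        s' a_O (man_node m w) = (woman_node m w).+1 /\ s' a_I (woman_node m w) = man_node m w,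
      forall x, s' a_O x != 0 -> exists m w, [/\ m < n, w < n, blocking m w & x = man_node m w],
      forall k i, 9 < k < 13 -> s' k i = 0
    & s' 0 v_ell = ell].
Proof.
move=> h s'.
pose s1 := sem F node_count s; pose s2 := sem F offsets s1; pose s3 := sem F ranks s2.
pose s4 := sem F partners s3; pose s5 := sem F nodes s4.
have es : s' = sem F arcs s5 := erefl.
have [h1 N1] : input_state s1 /\ s1 0 v_N = N := node_count_correct h.
have [n2 N2 o2] : [/\ s2 0 v_n = n, s2 0 v_N = N & forall k, k < 2 * n -> s2 a_off k = k * n]
  := offsets_correct h1 N1.
have z2 k i : 1 < k < 16 -> k != a_off -> s2 k i = 0.
  by move=> lk /eqP ko; rewrite /s2 sem_frame ?(in_zero h1) //=; lia.
have r3 : forall k x, k < 2 * n -> x < n -> s3 a_rank (k * n + x) = rank k x.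
  apply: ranks_correct => // [k i lk li|i]; last exact: z2.
  by rewrite /s2 sem_frame //; apply: in_lst h1 _ _ lk li.
have n3 : s3 0 v_n = n by rewrite /s3 sem_frame.
have N3 : s3 0 v_N = N by rewrite /s3 sem_frame.
have p4 : forall k, k < 2 * n -> s4 a_part k = part k.
  apply: partners_correct => // [m lm|k lk].
    by rewrite /s3 sem_frame // /s2 sem_frame //; apply: in_mu h1 _ lm.
  by rewrite /s3 sem_frame // o2.
have n4 : s4 0 v_n = n by rewrite /s4 sem_frame.
have N4 : s4 0 v_N = N by rewrite /s4 sem_frame.
have z4 k i : 4 < k < 16 -> s4 k i = 0.
  by move=> lk; rewrite /s4 sem_frame /s3 ?sem_frame ?z2 //=; lia.
have [C5 S5 T5 n5 N5] : [/\ s5 a_C =1 net_C, s5 a_S =1 net_S, s5 a_T =1 net_T, s5 0 v_n = n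
    & s5 0 v_N = N].
  by apply: nodes_correct => // k i lk; apply: z4; lia.
have o5 k : k < 2 * n -> s5 a_off k = k * n.
  by move=> lk; rewrite /s5 sem_frame // /s4 sem_frame // /s3 sem_frame // o2.
have r5 k x : k < 2 * n -> x < n -> s5 a_rank (k * n + x) = rank k x.
  by move=> lk lx; rewrite /s5 sem_frame // /s4 sem_frame // r3.
have p5 k : k < 2 * n -> s5 a_part k = part k by move=> lk; rewrite /s5 sem_frame // p4.
have z5 i : s5 a_O i = 0 by rewrite /s5 sem_frame // z4.
have [A5 B5] := arcs_correct n5 N5 o5 r5 p5 z5.
rewrite es; split=> //.
- by split=> v; rewrite sem_frame.
- by move=> k i lk; rewrite sem_frame /s5 ?sem_frame ?z4 //=; lia.
- rewrite sem_frame // /s5 sem_frame // /s4 sem_frame // /s3 sem_frame // /s2 sem_frame //.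
  exact: in_ell h1.
Qed.

End Stages.
End Build.

(** * The decision procedure *)

(** With truncated subtraction the answer is 1 exactly when the flow value is at most the budget. *)
Definition decide : cmd :=
  build ;; max_flow ;; v_ans ::= ESub (EC 1) (ESub (V v_val) (V v_ell)).

(** The certificate cut yields thresholds of total at most the flow value; conversely, any
    thresholds yield a cut, which bounds the flow value by weak duality. *)
Lemma decide_correct F n ell lst mu nu s : 0 < n -> 2 + 2 * (n * n) + n <= F ->
  (forall k, k < 2 * n -> perm_eq (lst k) (iota 0 n)) ->
  (forall m, m < n -> mu m < n) -> (forall w, w < n -> nu w < n) ->
  (forall m, m < n -> nu (mu m) = m) -> (forall w, w < n -> mu (nu w) = w) ->
  input_state n ell lst mu s ->
  sem F decide s 0 v_ans = 1 <->
  exists2 K, covers n lst mu nu K & \sum_(k < 2 * n) K k <= ell.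
Proof.
move=> n0 leF lp mlt nlt mK nK hs.
set N := 2 * (n * n) in leF.
have plt := part_lt lp mlt nlt.
pose s1 := sem F build s.
have := build_correct n0 lp mlt nlt mK nK leF hs.
cbv zeta; rewrite -/s1; case=> -[eC eS eT] hb1 hb2 hz el.
have O_node v u : s1 a_O v = u.+1 -> [/\ v < N, u < N & s1 a_I u = v].
  move=> e; have [|m [w [lm lw b ev]]] := hb2 v; first by rewrite e.
  have [e1 e2] := hb1 m w lm lw b; move: e; rewrite ev e1 => -[<-].
  have lm2 : m < 2 * n by lia.
  have lw2 : n + w < 2 * n by lia.
  split=> //; apply: (lt_node n0) => //; last exact: rank_lt.
  by have := plt m lm2; lia.
have C_node u : net_C n lst mu nu u != 0 -> 0 < u < N.
  by rewrite /net_C -/N; case: u => [|u]; rewrite ?mod0n ?andbF //; case: (_ < N).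
have leNF : N <= F by lia.
have ltNF : N < F by lia.
have SN v : net_S n lst mu nu v != 0 -> v < N.
  rewrite /net_S /N; case: (ltnP v (n * n)) => //; lia.
have := max_flow_correct C_node O_node leNF ltNF (fun v => leq_b1 _) (fun v => leq_b1 _) SN
  (And3 eC (frefl _) (frefl _)) eS eT (fun v => hz 10 v isT) (fun v => hz 11 v isT)
  (fun v => hz 12 v isT).
cbv zeta; set s2 := sem F max_flow s1; case=> h1 [X cX lX].
have ans : sem F decide s 0 v_ans = 1 - (s2 0 v_val - ell).
  by rewrite -el -(@sem_frame F max_flow s1 0 v_ell).
have O_blocking m w lm lw b := proj1 (hb1 m w lm lw b).
rewrite ans; split=> [e|[K cK lK]].
  have [K cK eK] := cut_covers n0 lp mlt nlt O_blocking cX.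
  by exists K => //; rewrite eK; apply: leq_trans lX _; lia.
have [Y cY lY] := covers_cut n0 lp mlt nlt O_blocking hb2 cK.
have le := leq_trans (h1 Y cY) (leq_trans lY lK).
by move: le; rewrite -subn_eq0 => /eqP ->.
Qed.

(** * From profiles and their encoding to rows of natural numbers *)

Section Instance.
Variables (n' : nat).
Let n := n'.+1.
Variables (P : profile n) (mu nu : 'I_n -> 'I_n) (ell : nat).
Hypotheses (vP : valid_profile P) (muK : cancel mu nu) (nuK : cancel nu mu).

Definition row_agent k : bool * 'I_n := if k < n then (true, inord k) else (false, inord (k - n)).
Definition row_list k : seq nat := map val (pref P (row_agent k)).
Definition nat_fun (f : 'I_n -> 'I_n) k : nat := f (inord k).

Lemma row_agent_man (m : 'I_n) : row_agent m = (true, m).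
Proof. by rewrite /row_agent ltn_ord inord_val. Qed.

Lemma row_agent_woman (w : 'I_n) : row_agent (n + w) = (false, w).
Proof. by rewrite /row_agent ltnNge leq_addr /= addKn inord_val. Qed.

Lemma row_list_perm k : perm_eq (row_list k) (iota 0 n).
Proof. by rewrite -val_enum_ord perm_map //; move/valid_prefP: vP; apply. Qed.

Lemma rank_row k (x : 'I_n) : rank row_list k x = index x (pref P (row_agent k)).
Proof. exact: index_map val_inj _ _. Qed.

Lemma part_row k : k < 2 * n ->
  part n row_list (nat_fun mu) (nat_fun nu) k =
    index (partner mu nu (row_agent k)) (pref P (row_agent k)).
Proof.
move=> lk; rewrite /part -rank_row /partner /nat_fun /row_agent.
by case: (k < n).
Qed.

Lemma encode_list k i : k < 2 * n -> i < n ->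
  encode P mu ell (k * n + i + 2) = nth 0 (row_list k) i.
Proof.
move=> lk li; have [e1 e2] := divmod_node (isT : 0 < n) k li.
have look (f : 'I_n -> seq 'I_n) (a : 'I_n) j : j = a * n + i ->
    lookup_list f j = nth 0 (map val (f a)) i.
  move=> ->; have [d1 d2] := divmod_node (isT : 0 < n) a li.
  by rewrite /lookup_list d1 d2 valK.
have lt : k.+1 * n <= 2 * n * n by rewrite leq_mul2r lk orbT.
rewrite /encode; do 2?(rewrite ifF; last lia).
rewrite /row_list /row_agent; case: (ltnP k n) => kn.
  have lt2 : k.+1 * n <= n * n by rewrite leq_mul2r kn orbT.
  rewrite ifT; last by rewrite mulSn in lt2; lia.
  by rewrite (look _ (inord k)) // inordK // addnK.
have gt : n * n <= k * n by rewrite leq_mul2r kn orbT.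
rewrite ifF; last lia.
rewrite ifT; last by move: lt; rewrite mulSn -mulnA; lia.
rewrite (look _ (inord (k - n))) // inordK; last lia.
by rewrite mulnBl; lia.
Qed.

Lemma encode_match m : m < n -> encode P mu ell (m + (2 * (n * n) + 2)) = nat_fun mu m.
Proof.
move=> lm; rewrite /encode; do 4?(rewrite ifF; last lia).
have -> : m + (2 * (n * n) + 2) - (2 + 2 * (n * n)) = Ordinal lm by rewrite /=; lia.
by rewrite valK /nat_fun; congr (val (mu _)); apply: val_inj; rewrite /= inordK.
Qed.

Lemma encode_out a : 2 * (n * n) + n + 2 <= a -> encode P mu ell a = 0.
Proof.
move=> la; rewrite /encode; do 4?(rewrite ifF; last lia).
by case: insubP => // u; lia.
Qed.

Lemma covers_covering :
  (exists2 K, covers n row_list (nat_fun mu) (nat_fun nu) K & \sum_(k < 2 * n) K k <= ell) <->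
  (exists2 K, covering mu nu P K & \sum_a K a <= ell).
Proof.
have sumE (K : nat -> nat) (K' : bool * 'I_n -> nat) :
    (forall m : 'I_n, K m = K' (true, m)) -> (forall w : 'I_n, K (n + w) = K' (false, w)) ->
    \sum_(k < 2 * n) K k = \sum_a K' a.
  move=> em ew; transitivity (\sum_(b : bool) \sum_(x < n) K' (b, x)).
    by rewrite mul2n -addnn big_split_ord big_bool /=; congr (_ + _); apply: eq_bigr.
  by rewrite pair_bigA /=; apply: eq_bigr => -[].
have man_lt (m : 'I_n) : m < 2 * n by have := ltn_ord m; lia.
have wom_lt (w : 'I_n) : n + w < 2 * n by have := ltn_ord w; lia.
have coverE (K : nat -> nat) (K' : bool * 'I_n -> nat) : (forall m : 'I_n, K m = K' (true, m)) ->
    (forall w : 'I_n, K (n + w) = K' (false, w)) ->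
    covers n row_list (nat_fun mu) (nat_fun nu) K <-> covering mu nu P K'.
  move=> em ew.
  have E (m w : 'I_n) : [/\ rank row_list m w = index w (P.1 m),
      rank row_list (n + w) m = index m (P.2 w),
      part n row_list (nat_fun mu) (nat_fun nu) m = index (mu m) (P.1 m)
    & part n row_list (nat_fun mu) (nat_fun nu) (n + w) = index (nu w) (P.2 w)].
    by rewrite !part_row // !rank_row row_agent_man row_agent_woman.
  split=> h m w.
    have [e1 e2 e3 e4] := E m w; rewrite -e1 -e2 -e3 -e4 -em -ew => b1 b2.
    by apply: h; rewrite // /blocking b1 b2.
  move=> lm lw /andP[]; have [] := E (Ordinal lm) (Ordinal lw).
  rewrite /= => -> -> -> -> b1 b2; have := h _ _ b1 b2.
  by rewrite -em -ew.
split=> -[K cK sK].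
  exists (fun a : bool * 'I_n => K (if a.1 then a.2 : nat else n + a.2)).
    exact: (proj1 (coverE K _ (fun _ => erefl) (fun _ => erefl)) cK).
  by rewrite -(sumE K).
have hm (m : 'I_n) : K (row_agent m) = K (true, m) by rewrite row_agent_man.
have hw (w : 'I_n) : K (row_agent (n + w)) = K (false, w) by rewrite row_agent_woman.
exists (fun k => K (row_agent k)); first exact: (proj2 (coverE _ K hm hw) cK).
by rewrite (sumE (fun k => K (row_agent k)) K hm hw).
Qed.

End Instance.

Definition answer := cexpr 8 (V v_ans) ++ [:: IConst 0 0; IAdd 0 0 8; IHalt].

(** The case [n = 0] is answered directly, as an instance without agents has no blocking pair. *)
Definition ees_prog : seq instr :=
  let body := prelude 1 ++ compile 0 87 decide ++ answer in
  IJz 0 (size body).+1 :: body ++ [:: IConst 0 1; IHalt].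

(** For positive [n], [F <= 20 * n ^ 2], so two nested loops cost at most [400 * n ^ 4] times
    [tconst decide]; 600 absorbs the prelude and the output. *)
Definition ees_const := 600 + 400 * tconst decide.

Lemma cwf_decide : cwf decide. Proof. by vm_compute. Qed.
Lemma depth_decide : depth decide = 2. Proof. by vm_compute. Qed.

Lemma goes_run prog b fuel pc M pc' (Q : memory -> Prop) : goes prog b pc M pc' Q ->
  b <= fuel -> nth IHalt prog pc' = IHalt -> exists M', run prog fuel pc M = Some M' /\ Q M'.
Proof.
move=> [t [M' [le r q]]] lef e; exists M'; split=> //.
by rewrite -(subnKC (leq_trans le lef)) r; case: (fuel - t) => [|f] /=; rewrite e.
Qed.

#[local] Opaque decide.

Section Program.
Variable prog : seq instr.
Hypothesis prog_code : code_at prog 0 ees_prog.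

Lemma ees_prog_empty M fuel : M 0 = 0 -> 2 <= fuel ->
  exists M', run prog fuel 0 M = Some M' /\ M' 0 = 1.
Proof.
move=> e0 lef; move: prog_code; rewrite /ees_prog; set body := _ ++ _ ++ _.
case/code_at_cons => h0 /code_at_cat[_ /code_at_cons[h1 /code_at_cons[h2 _]]].
have g : goes prog 2 0 M (1 + size body).+1 (fun M' => M' 0 = 1).
  apply: (goes_step h0) => //=; rewrite e0 /=.
  by apply: (goes_step h1) => //=; apply: goes_refl.
exact: goes_run g lef h2.
Qed.

Lemma ees_prog_correct n (E : memory) ell lst mu nu fuel : 0 < n -> E 0 = n -> E 1 = ell ->
  (forall a, 2 * (n * n) + n + 2 <= a -> E a = 0) ->
  (forall k, k < 2 * n -> perm_eq (lst k) (iota 0 n)) ->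
  (forall m, m < n -> mu m < n) -> (forall w, w < n -> nu w < n) ->
  (forall m, m < n -> nu (mu m) = m) -> (forall w, w < n -> mu (nu w) = w) ->
  (forall k i, k < 2 * n -> i < n -> E (k * n + i + 2) = nth 0 (lst k) i) ->
  (forall m, m < n -> E (m + (2 * (n * n) + 2)) = mu m) ->
  ees_const * n ^ 4 + ees_const <= fuel ->
  exists M', run prog fuel 0 E = Some M' /\
    (M' 0 = 1 <-> exists2 K, covers n lst mu nu K & \sum_(k < 2 * n) K k <= ell).
Proof.
move=> n0 e0 e1 ez lp mlt nlt mK nK el em lef.
move: prog_code; rewrite /ees_prog; set body := _ ++ _ ++ _.
case/code_at_cons => h0 /code_at_cat[/code_at_cat[cp /code_at_cat[cd ca]] _].
have sp : 1 + size (prelude 1) = 87 by [].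
rewrite sp in cd ca; set pa := 87 + size (compile 0 87 decide) in ca.
case/code_at_cat: ca => ca1 /code_at_cons[ca2 /code_at_cons[ca3 /code_at_cons[ca4 _]]].
set F := frame_size n.
have F_eq : F = 16 + 2 * (n * n.+1) by [].
have leF : 16 <= F by lia.
have leFn : 2 + 2 * (n * n) + n <= F by lia.
have hp := prelude_correct n0 e0 ez cp.
pose Q (M' : memory) :=
  M' 0 = 1 <-> exists2 K, covers n lst mu nu K & \sum_(k < 2 * n) K k <= ell.
have hd M : loaded n E M -> goes prog (time F decide) 87 M pa (fun M2 => exists2 s2, rep F M2 s2
    & s2 0 v_ans = 1 <-> exists2 K, covers n lst mu nu K & \sum_(k < 2 * n) K k <= ell).
  rewrite /loaded -/F => -[m1 mn mell ml mz].
  pose s : state := fun k i => M (F + 16 * i + k).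
  have rs : rep F M s by split.
  have hs : input_state n ell lst mu s.
    split=> [|| k i lk li | m lm | k i lk].
    + by rewrite /s -mn; congr M; lia.
    + by rewrite /s -e1 -mell; congr M; lia.
    + have lt := lt_node n0 lk (proj2 (andP li)).
      rewrite /s ml ?el //; [by case/andP: li|lia|].
      (* The parked cell [n + 2] is column 0 of row 1, whereas here the column is positive. *)
      apply/eqP => e; have e' : k * n + i = 1 * n + 0 by lia.
      by have [_ i0] := pair_inj (proj2 (andP li)) n0 e'; rewrite i0 in li.
    + have le : n <= n * n by rewrite leq_pmulr.
      by rewrite /s ml ?em //; lia.
    + by rewrite /s mz.
  have d6 : 0 + depth decide <= 6 by rewrite depth_decide.
  apply: goes_weaken (leqnn _) _ (comp_correct cwf_decide d6 cd rs) => M2 [r2 _].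
  by exists (sem F decide s) => //; apply: decide_correct.
have ha M2 s2 : rep F M2 s2 ->
    goes prog (size (cexpr 8 (V v_ans)) + 2) pa M2 (pa + size (cexpr 8 (V v_ans))).+2
      (fun M' => M' 0 = s2 0 v_ans).
  move=> r2; have [v _] := @exec_cexpr F 8 (V v_ans) M2 _ isT r2 isT isT.
  have hx := goes_exec M2 ca1 (straight_cexpr _ _).
  apply: goes_trans (leqnn _) hx _ => _ ->; set M3 := exec _ _ in v *; clearbody M3.
  by apply: (goes_step ca2) => //; apply: (goes_step ca3) => //; apply: goes_refl; exact: v.
have h : goes prog (1 + (20 * F + 100 + (time F decide + (size (cexpr 8 (V v_ans)) + 2)))) 0 E
    (pa + size (cexpr 8 (V v_ans))).+2 Q.
  apply: (goes_step h0) => //; rewrite /step e0 -(prednK n0) [_.+1 == 0]/=.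
  apply: goes_trans (leqnn _) hp _ => M hM.
  apply: goes_trans (leqnn _) (hd M hM) _ => M2 [s2 r2 e2].
  by apply: goes_weaken (leqnn _) _ (ha M2 s2 r2) => M3; rewrite /Q => ->.
apply: goes_run h _ ca4; apply: leq_trans lef.
have t2 : time F decide <= tconst decide * (400 * n ^ 4).
  have F0 : 0 < F by lia.
  apply: leq_trans (time_le decide F0) _; rewrite depth_decide leq_mul2l; apply/orP; right.
  have F20 : F <= 20 * n ^ 2 by rewrite F_eq; case: (n) n0 => // k _; lia.
  have := leq_mul F20 F20; rewrite mulnn (expnD n 2 2); move: (n ^ 2) => x; lia.
have F20 : F <= 20 * n ^ 4 by rewrite F_eq; case: (n) n0 => // k _; nia.
have sz : size (cexpr 8 (V v_ans)) = 9 by [].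
rewrite sz /ees_const; move: (tconst decide) t2 F20; move: (n ^ 4) => x c; lia.
Qed.

End Program.

Theorem mainTheorem12 :
  exists (prog : seq instr) (c : nat),
    forall (n : nat) (P : profile n) (mu : 'I_n -> 'I_n) (ell : nat),
      valid_profile P -> injective mu ->
      exists M : memory,
        run prog (c * n ^ 4 + c) 0 (encode P mu ell) = Some M /\
        (M 0 = 1 <-> EES P mu ell).
Proof.
(* Program and constant are made abstract so that no step unfolds the compiled code. *)
suff [prog code] : exists prog, code_at prog 0 ees_prog.
suff [c ec] : exists c, ees_const = c.
exists prog, c => -[|n] P mu ell vP injmu.
  have [|M [r e]] := ees_prog_empty code (M := encode P mu ell) (fuel := c * 0 ^ 4 + c) erefl.
    by rewrite -ec /ees_const; lia.
  exists M; split; first exact: r.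
  by split=> // _; exists [::]; split=> // -[].
have [nu muK nuK] := injF_bij injmu.
have lef : ees_const * n.+1 ^ 4 + ees_const <= c * n.+1 ^ 4 + c by rewrite ec.
have mK m : m < n.+1 -> nat_fun nu (nat_fun mu m) = m.
  by move=> lm; rewrite /nat_fun inord_val muK inordK.
have nK w : w < n.+1 -> nat_fun mu (nat_fun nu w) = w.
  by move=> lw; rewrite /nat_fun inord_val nuK inordK.
have [M [r e]] := @ees_prog_correct prog code n.+1 (encode P mu ell) ell (row_list P) (nat_fun mu)
  (nat_fun nu) _ isT erefl erefl (@encode_out n P mu ell) (fun k _ => row_list_perm vP k)
  (fun m _ => ltn_ord _) (fun w _ => ltn_ord _) mK nK (@encode_list n P mu ell)
  (@encode_match n P mu ell) lef.
exists M; split; first exact: r.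
exact: iff_trans e (iff_trans (covers_covering P mu nu ell) (iff_sym (EES_covering muK nuK _ vP))).
- by exists ees_const.
- by exists ees_prog => i _; rewrite add0n.
Qed.
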